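(* With universal constants of equivalence, for all $p>1$, $$\|K\|_{L_p\to L_p}\asymp\|K\|_{\Lambda(t^{1/p})\to\Lambda(t^{1/p})}\asymp\|K\|_{M(t^{1/p})\to M(t^{1/p})}\asymp\frac{p}{\ln(p+1)},$$ where $K$ is the Kruglov operator. That is, there are constants $0<a<b<\infty$, independent of $p$, such that each of the three operator norms lies between $a\,\frac{p}{\ln(p+1)}$ and $b\,\frac{p}{\ln(p+1)}$ for every $p>1$.
   Context: All function spaces are on $[0,1]$ with Lebesgue measure $\lambda$; $f^*$ denotes the decreasing rearrangement of $|f|$. For a positive concave function $\psi$ on $[0,1]$ with $\psi(0+)=0$, the Lorentz space $\Lambda(\psi)$ has norm $\|f\|_{\Lambda(\psi)}=\int_0^1f^*(s)\,d\psi(s)$ and the Marcinkiewicz space $M(\psi)$ has norm $\|f\|_{M(\psi)}=\sup_{0<t\le1}\frac{\psi(t)}{t}\int_0^tf^*(s)\,ds$. Kruglov operator: let $\{B_n\}_{n\ge1}$ be pairwise disjoint measurable subsets of $[0,1]$ with $\lambda(B_n)=\frac1{e\,n!}$, and let $(\Omega,\mathcal P)=\prod_{n=0}^\infty([0,1],\lambda_n)$ with each $\lambda_n$ Lebesgue measure on $[0,1]$. For $f\in L_1[0,1]$, $$Kf(\omega_0,\omega_1,\dots)=\sum_{n=1}^\infty\sum_{k=1}^n f(\omega_k)\chi_{B_n}(\omega_0).$$ For $X$ and $Y$ any of the spaces $L_p=L_p[0,1]$, $\Lambda(t^{1/p})$, $M(t^{1/p})$ with $p>1$ (the last two being the Lorentz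 space $\Lambda(\psi)$ and the Marcinkiewicz space $M(\psi)$ with $\psi(t)=t^{1/p}$), $\|Kf\|_Y$ means $\|(Kf)^*\|_Y$, and $\|K\|_{X\to Y}:=\sup_{\|f\|_X\le1}\|Kf\|_Y$. *)

(* Defs.v *)
From HB Require Import structures.
From mathcomp Require Import all_boot all_order all_algebra.
From mathcomp Require Import all_classical all_reals all_analysis.

Set Implicit Arguments.
Unset Strict Implicit.
Unset Printing Implicit Defensive.

Import Order.TTheory GRing.Theory Num.Theory.
Import numFieldNormedType.Exports.

Local Open Scope classical_set_scope.
Local Open Scope ring_scope.

(* The space [0,1] is the real line carrying this measure: points outside
   [0,1] form a null set, so functions on [0,1] are functions on R. *)
Definition lebesgue01 {R : realType} : set (measurableTypeR R) -> \bar R :=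
  mrestr (@lebesgue_measure R) (measurable_itv `[0 : R, 1]).

HB.instance Definition _ (R : realType) := Measure.on (@lebesgue01 R).

(* At t = 0 the value is +oo exactly when g is essentially unbounded. *)
Definition rearrangement {d} {T : measurableType d} {R : realType}
    (mu : set T -> \bar R) (g : T -> \bar R) (t : R) : \bar R :=
  ereal_inf [set s%:E | s in
    [set s : R | 0 <= s /\ (mu [set x | s%:E < `|g x|] <= t%:E)%E]].

Definition Lp_norm {R : realType} (p : R) (g : R -> \bar R) : \bar R :=
  Lnorm lebesgue01 p%:E g.

(* Integrating over ]0,1] involves psi on [0,1] only, and no atom at 0;
   this is the integral over [0,1] because psi(0+) = psi(0) = 0. *)
Definition lorentz_norm {R : realType} (psi : cumulative R R)
    (g : R -> \bar R) : \bar R :=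
  (\int[lebesgue_stieltjes_measure psi]_(s in `]0%R, 1%R])
    rearrangement lebesgue01 g s)%E.

Definition marcinkiewicz_norm {R : realType} (psi : R -> R)
    (g : R -> \bar R) : \bar R :=
  ereal_sup [set ((psi t / t)%:E *
      \int[lebesgue_measure]_(s in `]0%R, t]) rearrangement lebesgue01 g s)%E
    | t in `]0, 1]].

(* t |-> t^(1/p), extended by 0 to t < 0 (powR is 1 there).  The proof that
   1 < p is an argument so that the function is canonically cumulative. *)
Definition root_fun {R : realType} (p : R) (p1 : 1 < p) (t : R) : R :=
  Num.max t 0 `^ p^-1.

Section root_fun_cumulative.
Context {R : realType} (p : R) (p1 : 1 < p).

Lemma root_fun_nd : {homo root_fun p1 : x y / x <= y}.
Proof.
move=> x y xy; rewrite /root_fun ge0_ler_powR//.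
- by rewrite invr_ge0 ltW// (lt_trans ltr01).
- by rewrite nnegrE le_max lexx orbT.
- by rewrite nnegrE le_max lexx orbT.
- by rewrite ge_max !le_max xy lexx !orbT.
Qed.

Lemma root_fun_rc : right_continuous (root_fun p1).
Proof.
have p0 : 0 < p^-1 by rewrite invr_gt0 (lt_trans ltr01).
move=> x; rewrite /root_fun.
have [x0|x0|->] := ltgtP x 0.
- apply: cvg_within_filter; apply: cvg_near_cst; near=> t.
  have t0 : t <= 0 by apply: ltW; near: t; exact: lt_nbhsl.
  by rewrite max_r.
- have lnx : p^-1 * ln t @[t --> x] --> p^-1 * ln x.
    by apply: cvgM; [exact: cvg_cst|exact: continuous_ln].
  have expx : expR (p^-1 * ln t) @[t --> x] --> expR (p^-1 * ln x).
    exact: continuous_cvg _ (@continuous_expR R _) lnx.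
  rewrite [X in _ --> X](_ : _ = expR (p^-1 * ln x)); last first.
    by rewrite /powR gt_eqF.
  apply: cvg_within_filter; apply: (cvg_trans _ expx).
  apply: near_eq_cvg; near=> t.
  have t0 : 0 < t by near: t; exact: lt_nbhsr.
  by rewrite max_l ?ltW// /powR gt_eqF.
- rewrite powR0 ?gt_eqF//.
  apply: (cvg_trans _ (powR_cvg0 p0)).
  apply: near_eq_cvg; near=> t.
  by rewrite max_l// ltW.
Unshelve. all: by end_near.
Qed.

HB.instance Definition _ :=
  isCumulative.Build R _ R (root_fun p1) root_fun_nd root_fun_rc.
End root_fun_cumulative.

Definition coordinate_sets (R : realType) : set (set (nat -> R)) :=
  [set C | exists n A, measurable A /\ C = [set w | A (w n)]].

Definition seq_space (R : realType) := g_sigma_algebraType (@coordinate_sets R).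

HB.instance Definition _ (R : realType) := Pointed.on (seq_space R).
HB.instance Definition _ (R : realType) := Measurable.on (seq_space R).

(* Characterises the product measure uniquely: the finite-dimensional
   cylinders are a pi-system generating the sigma-algebra. *)
Definition is_product01 {R : realType} (P : set (seq_space R) -> \bar R) :=
  forall (n : nat) (A : nat -> set R), (forall i, measurable (A i)) ->
    P [set w : seq_space R | forall i, (i < n)%N -> A i (w i)] =
    (\prod_(i < n) lebesgue01 (A i))%E.

Definition kruglov_partition {R : realType} (B : nat -> set R) :=
  [/\ forall n, (0 < n)%N -> measurable (B n),
      forall n, (0 < n)%N -> B n `<=` `[0, 1],
      trivIset [set n | (0 < n)%N] B &
      forall n, (0 < n)%N ->
        lebesgue_measure (B n) = ((expR 1 * n`!%:R)^-1)%:E].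

(* The outer series has at most one nonzero term at each point. *)
Definition kruglov {R : realType} (B : nat -> set R) (f : R -> R)
    (w : seq_space R) : R :=
  \big[+%R/0]_(1 <= n <oo) \sum_(1 <= k < n.+1) f (w k) * \1_(B n) (w 0%N).

(* NX and NY are norms on (extended real) functions on [0,1]. *)
Definition kruglov_opnorm {R : realType} (P : set (seq_space R) -> \bar R)
    (B : nat -> set R) (NX NY : (R -> \bar R) -> \bar R) : \bar R :=
  ereal_sup [set NY (rearrangement P (EFin \o kruglov B f)) | f in
    [set f : R -> R | measurable_fun setT f /\ (NX (EFin \o f) <= 1)%E]].

(* Main.v *)
Require Import Defs.
From HB Require Import structures.
From mathcomp Require Import all_boot all_order all_algebra.
From mathcomp Require Import all_classical all_reals all_analysis.
From mathcomp Require Import measurable_realfun ring lra.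
Import Order.TTheory GRing.Theory Num.Theory.
Import numFieldNormedType.Exports.
Local Open Scope classical_set_scope.
Local Open Scope ring_scope.
Set Implicit Arguments.
Unset Strict Implicit.
Unset Printing Implicit Defensive.

(** Write N for the number of summands: N = n on B_n and N = 0 elsewhere, so that
    N is a Poisson variable of parameter 1 and P(N >= k) <= 1/k!. Grouping the
    double sum by coordinates gives K f = sum_{k >= 1} g_k with
    g_k = f(w_k) 1_{N >= k}, and the tail z |-> P(|g_k| > z) is at most 1/k! times
    that of f. In each of the three spaces, multiplying the tail by c multiplies
    the norm by c^(1/p). Hence the triangle inequality gives
<<
      ||K f|| <= ||f|| sum_{k >= 1} (1/k!)^(1/p),
>>
    and the sum is at most 2 e^2 p / ln (p + 1) ([sum_root_invfact]), because
    k! >= y^k e^(-y) with y = sqrt (p + 1) dominates it by a geometric series.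
    Grouping by the value of N instead would, for large p, lose a factor of order
    p / ln p.

    The bulk of the work is the countable triangle inequality for norms defined by
    rearrangements. Everything is expressed by tails. The rearrangement is the
    generalized inverse of the tail ([lt_rearrangement]), and Tonelli's
    theorem ([layer_cake]) turns the integral of the rearrangement over ]0,t] into
    the integral of min (tail z) t, and the Lorentz norm into the integral of
    (tail z)^(1/p). For truncated tails the triangle inequality
    [kruglov_min_tail] follows from the variational formula
<<
      int min (tail z) t dz = inf_Y (t Y + int (|g| - Y)^+),
>>
    whose infimum is attained at the value of the rearrangement at t; this gives
    the Marcinkiewicz space. The root s^(1/p) is equivalent, with the constant 2
    for all p, to a positive combination of the functions min s 2^(-j)
    ([dyadic_root_equiv]), so the Lorentz space follows by summation over j. For
    L_p the triangle inequality is replaced by convexity of the p-th power with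
    suitable weights ([kruglov_Lp]).

    For the lower bound take f = 1. Then K f = N is at least n on a set of measure
    1/(e n!), so each norm is at least n (1/(e n!))^(1/p), and n of order
    p / ln (p + 1) makes the second factor bounded below
    ([exists_poisson_lower]). *)

(** * The layer cake formula *)

Lemma lebesgue_measure_itv0 (R : realType) (b1 b2 : bool) (y : R) : 0 <= y ->
  lebesgue_measure ([set` Interval (BSide b1 0) (BSide b2 y)] : set R) = y%:E.
Proof.
move=> y0; rewrite lebesgue_measure_itv/= lte_fin.
by case: ltgtP y0 => // [_|<-] _; rewrite ?oppr0 ?adde0.
Qed.

Section layer_cake.
Context d (T : measurableType d) (R : realType).
Local Open Scope ereal_scope.

Lemma lebesgue_measure_co_lt (y : R) (a : \bar R) :
  lebesgue_measure (`[y, +oo[ `&` [set z | z%:E < a] : set R) =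
  maxe (a - y%:E) 0.
Proof.
case: a => [a| |].
- have -> : `[y, +oo[ `&` [set z | z%:E < a%:E] = `[y, a[%classic :> set R.
    by apply/seteqP; split=> z /=; rewrite !in_itv/= lte_fin andbT;
      [move=> [-> ->]|move=> /andP[]].
  rewrite lebesgue_measure_itv/= lte_fin.
  case: ltP => ya.
    by rewrite max_l// -EFinB lee_fin subr_ge0 ltW.
  by rewrite max_r// -EFinB lee_fin subr_le0.
- have -> : `[y, +oo[ `&` [set z | z%:E < +oo] = `[y, +oo[%classic :> set R.
    by apply/seteqP; split=> z /=; [case|rewrite ltry].
  by rewrite lebesgue_measure_itv/= ltry max_l ?leey.
- have -> : `[y, +oo[ `&` [set z | z%:E < -oo] = set0 :> set R.
    by rewrite -subset0 => z /= [].
  by rewrite measure0 max_r ?leNye.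
Qed.

(** For y = 0 and h nonnegative this is the usual layer cake formula. The base
    point y makes the excess of h over the level y available as well. *)
Lemma layer_cake (mu : {sigma_finite_measure set T -> \bar R})
    (h : T -> \bar R) (y : R) : measurable_fun setT h ->
  \int[mu]_x maxe (h x - y%:E) 0 =
  \int[lebesgue_measure]_(z in `[y, +oo[) mu [set x | z%:E < h x].
Proof.
move=> mh.
pose A : set (T * measurableTypeR R) := [set p | (y <= p.2)%R /\ p.2%:E < h p.1].
have mA : measurable A.
  have -> : A = (setT `*` `[y, +oo[) `&` [set p | p.2%:E < h p.1].
    by apply/seteqP; split => p; rewrite /A /= in_itv/= andbT;
      [move=> []|move=> [[]]].
  apply: measurableI; first exact: measurableX.
  rewrite -[X in measurable X]setTI.
  have m1 : measurable_fun [set: T * measurableTypeR R] (fun p => (p.2 : R)%:E).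
    apply/measurable_EFinP; exact: measurable_snd.
  have m2 : measurable_fun [set: T * measurableTypeR R] (fun p => h p.1).
    exact: measurableT_comp mh measurable_fst.
  exact: measurable_lte.
(* A is the region between the level y and the graph of h; its sections in the
   two directions give the two integrals. *)
have := @indic_fubini_tonelli _ _ _ _ R mu
  (@lebesgue_measure R : {sigma_finite_measure set (measurableTypeR R) -> \bar R})
  A mA.
rewrite indic_fubini_tonelli_FE// indic_fubini_tonelli_GE// => e.
transitivity (\int[mu]_x ((lebesgue_measure \o xsection A) x)).
  apply: eq_integral => x _ /=; rewrite -lebesgue_measure_co_lt; congr (lebesgue_measure _).
  by apply/seteqP; split => z; rewrite /xsection/= inE /A/= in_itv/= andbT.
rewrite e integral_mkcond [RHS]integral_mkcond !patch_setT.
apply: eq_integral => z _; rewrite patchE.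
case: ifPn; rewrite ?inE ?notin_setE /= in_itv/= andbT => yz.
  by congr (mu _); apply/seteqP; split => x; rewrite /ysection/= inE /A/=;
    [case|].
rewrite [X in mu X](_ : _ = set0) ?measure0//.
by rewrite -subset0 => x; rewrite /ysection/= inE /A/= => -[].
Qed.

Lemma ge0_layer_cake (mu : {sigma_finite_measure set T -> \bar R})
    (D : set T) (h : T -> \bar R) : measurable D -> measurable_fun D h ->
    (forall x, D x -> 0 <= h x) ->
  \int[mu]_(x in D) h x =
  \int[lebesgue_measure]_(z in `[0%R, +oo[) mu (D `&` [set x | z%:E < h x]).
Proof.
move=> mD mh h0; rewrite integral_mkcond.
transitivity (\int[mu]_x maxe ((h \_ D) x - 0%:E) 0).
  apply: eq_integral => x _; rewrite sube0 max_l// patchE.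
  by case: ifPn => //; rewrite inE; exact: h0.
rewrite layer_cake; last exact/(measurable_restrictT _ mD).1.
apply: eq_integral => z; rewrite inE/= in_itv/= andbT => z0.
congr (mu _); apply/seteqP; split => x /=; rewrite patchE.
  by case: ifPn; rewrite ?inE// lte_fin ltNge z0.
by move=> [Dx]; rewrite mem_set.
Qed.

End layer_cake.

(** * Tails and rearrangements *)

Lemma lebesgue01_setT (R : realType) :
  @lebesgue01 R [set: measurableTypeR R] = 1%E.
Proof.
by rewrite /lebesgue01 /mrestr setTI lebesgue_measure_itv0.
Qed.

HB.instance Definition _ (R : realType) :=
  Measure_isProbability.Build _ _ R (@lebesgue01 R) (@lebesgue01_setT R).

(** Real valued, since only probability measures are considered. *)
Definition tail d (T : measurableType d) (R : realType) (P : set T -> \bar R)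
  (g : T -> \bar R) (y : R) : R := fine (P [set x | (y%:E < `|g x|)%E]).

Section tail.
Context d (T : measurableType d) (R : realType) (P : probability T R).
Implicit Types (g : T -> \bar R) (y t : R).

Lemma measurable_tail_set g y : measurable_fun setT g ->
  measurable [set x | (y%:E < `|g x|)%E].
Proof.
move=> mg; rewrite -[X in measurable X]setTI.
by apply: emeasurable_fun_o_infty => //; exact: measurableT_comp.
Qed.

Lemma EFin_tail g y : measurable_fun setT g ->
  (tail P g y)%:E = P [set x | (y%:E < `|g x|)%E].
Proof.
by move=> mg; rewrite /tail fineK// fin_num_measure//; exact: measurable_tail_set.
Qed.

Lemma tail_ge0 g y : 0 <= tail P g y.
Proof. by rewrite fine_ge0. Qed.

Lemma tail_le1 g y : measurable_fun setT g -> tail P g y <= 1.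
Proof.
move=> mg; rewrite -lee_fin EFin_tail//.
exact/probability_le1/measurable_tail_set.
Qed.

Lemma tail_nonincreasing g : measurable_fun setT g ->
  {homo tail P g : x y /~ x <= y}.
Proof.
move=> mg y x xy; rewrite -lee_fin !EFin_tail// le_measure ?inE//.
- exact: measurable_tail_set.
- exact: measurable_tail_set.
- by move=> w /=; apply: le_lt_trans; rewrite lee_fin.
Qed.

Lemma measurable_tail g (D : set R) : measurable_fun setT g -> measurable D ->
  measurable_fun D (tail P g).
Proof.
move=> mg mD; apply: nonincreasing_measurable => // x y xy.
exact: tail_nonincreasing.
Qed.

(** Right continuity of the tail: the events {|g| > y'} increase to {|g| > y} as
    y' decreases to y. *)
Lemma tail_right g y t : measurable_fun setT g -> t < tail P g y ->
  exists2 y', y < y' & t < tail P g y'.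
Proof.
move=> mg ty.
pose F n := [set x | ((y + n.+1%:R^-1)%:E < `|g x|)%E].
have bigF : \bigcup_n F n = [set x | (y%:E < `|g x|)%E].
  apply/seteqP; split => [x [n _]|x]; rewrite /F/=.
    by apply: le_lt_trans; rewrite lee_fin lerDl.
  move=> yg; have [r yr rg] : exists2 r, y < r & (r%:E <= `|g x|)%E.
    move: yg; case: `|g x|%E => [r||//]; first by rewrite lte_fin; exists r.
    by exists (y + 1); rewrite ?ltrDl ?leey.
  have r0 : 0 < r - y by rewrite subr_gt0.
  exists (Num.bound (r - y)^-1) => //=; apply: (lt_le_trans _ rg).
  rewrite lte_fin -ltrBrDl invf_plt ?posrE//.
  apply: (lt_trans (archi_boundP _)); first by rewrite ltW ?invr_gt0.
  by rewrite ltr_nat.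
have mF n : measurable (F n) by exact: measurable_tail_set.
have ndF : nondecreasing_seq F.
  move=> m n mn; apply/subsetPset => x; rewrite /F/=; apply: le_lt_trans.
  by rewrite lee_fin lerD2l lef_pV2 ?posrE// ler_nat.
have cF : P \o F @ \oo --> (tail P g y)%:E.
  rewrite EFin_tail// -bigF.
  by apply: nondecreasing_cvg_mu => //; exact: bigcupT_measurable.
have : \forall n \near \oo, t < (fine \o (P \o F)) n.
  by apply: (cvgr_gt (tail P g y)) => //; exact: fine_cvg cF.
by move=> [n _ /(_ n (leqnn n))] ?; exists (y + n.+1%:R^-1); rewrite ?ltrDl.
Qed.

(** The rearrangement is the generalized inverse of the tail. Strict
    inequalities on both sides are what right continuity provides. *)
Lemma lt_rearrangement g y t : measurable_fun setT g -> 0 <= y ->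
  (y%:E < rearrangement P g t)%E = (t < tail P g y).
Proof.
move=> mg y0; apply/idP/idP => [|ty].
  apply: contraTT; rewrite -!leNgt => ty.
  apply: ereal_inf_lbound; exists y => //; split=> //=.
  by rewrite -EFin_tail// lee_fin.
have [y' yy' ty'] := tail_right mg ty.
apply: (@lt_le_trans _ _ y'%:E); first by rewrite lte_fin.
apply: le_ereal_inf_tmp => _ [s [s0 +] <-]; rewrite -EFin_tail// !lee_fin => st.
rewrite leNgt; apply: contraTN ty' => sy'; rewrite -leNgt.
by apply: le_trans st; exact/tail_nonincreasing/ltW.
Qed.

Lemma rearrangement_ge0 g t : (0 <= rearrangement P g t)%E.
Proof. by apply: le_ereal_inf_tmp => _ [s [s0 _] <-]. Qed.

Lemma measurable_rearrangement g (D : set R) : measurable_fun setT g ->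
  measurable D -> measurable_fun D (rearrangement P g).
Proof.
move=> mg mD; apply: (measurability _ (ErealGenOInfty.measurableE R)) => //.
move=> _ [_ [x ->] <-]; apply: measurableI => //.
rewrite preimage_itvoy; have [x0|x0] := leP 0 x; last first.
  rewrite [X in measurable X](_ : _ = setT)// -subTset => t _ /=.
  by apply: lt_le_trans (rearrangement_ge0 _ _); rewrite lte_fin.
rewrite [X in measurable X](_ : _ = `]-oo, tail P g x[%classic)//.
by apply/seteqP; split => t /=; rewrite in_itv/= lt_rearrangement.
Qed.

Lemma lebesgue01_lt (a : R) : 0 <= a -> a <= 1 ->
  lebesgue01 [set t : R | t < a] = a%:E.
Proof.
move=> a0 a1; rewrite /lebesgue01 /mrestr.
have -> : [set t : R | t < a] `&` `[0, 1] = `[0, a[%classic.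
  apply/seteqP; split => t /=; rewrite !in_itv/=.
    by move=> [ta /andP[-> _]].
  move=> /andP[-> ta]; split => //=.
  exact: ltW (lt_le_trans ta a1).
exact: lebesgue_measure_itv0.
Qed.

(** By [lt_rearrangement] the superlevel sets of the rearrangement are initial
    segments of [0,1] whose lengths are the tails. *)
Lemma lebesgue01_rearrangement g y : measurable_fun setT g -> 0 <= y ->
  lebesgue01 [set t | (y%:E < `|rearrangement P g t|)%E] =
  P [set x | (y%:E < `|g x|)%E].
Proof.
move=> mg y0; rewrite -EFin_tail// -(lebesgue01_lt (tail_ge0 g y))//; last first.
  exact: tail_le1.
congr (lebesgue01 _); apply/seteqP; split => t /=;
by rewrite gee0_abs ?rearrangement_ge0// lt_rearrangement.
Qed.

(** A rearrangement depends on the function through its tail only. *)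
Lemma rearrangement_idem g : measurable_fun setT g ->
  rearrangement lebesgue01 (rearrangement P g) = rearrangement P g.
Proof.
move=> mg; apply/funext => t; rewrite [LHS]/rearrangement [RHS]/rearrangement.
congr (ereal_inf (_ @` _)); apply/seteqP; split => s /= [s0].
  by rewrite lebesgue01_rearrangement.
by rewrite -lebesgue01_rearrangement.
Qed.

End tail.

(** * The norms in terms of tails *)

Section root_function.
Variable R : realType.
Implicit Types p : R.

Lemma root_funE p (p1 : 1 < p) (s : R) : 0 <= s -> root_fun p1 s = s `^ p^-1.
Proof. by move=> s0; rewrite /root_fun max_l. Qed.

Lemma powRVK p (s : R) : 0 < p -> 0 <= s -> (s `^ p^-1) `^ p = s.
Proof. by move=> p0 s0; rewrite -powRrM mulVf ?gt_eqF// powRr1. Qed.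

Lemma powRKV p (s : R) : 0 < p -> 0 <= s -> (s `^ p) `^ p^-1 = s.
Proof. by move=> p0 s0; rewrite -powRrM mulfV ?gt_eqF// powRr1. Qed.

Lemma lt_poweR p (z : R) (a : \bar R) : 0 < p -> 0 <= z -> (0 <= a)%E ->
  (z%:E < a `^ p)%E = ((z `^ p^-1)%:E < a)%E.
Proof.
move=> p0 z0; case: a => [a||//]; last first.
  by rewrite poweRyr ?gt_eqF// !ltry.
rewrite lee_fin poweR_EFin !lte_fin => a0; apply/idP/idP => h.
  rewrite -(powRKV p0 a0) gt0_ltr_powR ?invr_gt0 ?nnegrE ?powR_ge0//.
by rewrite -(powRVK p0 z0) gt0_ltr_powR ?nnegrE ?powR_ge0.
Qed.

Lemma stieltjes_root_itv p (p1 : 1 < p) (a : R) : 0 <= a ->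
  lebesgue_stieltjes_measure (root_fun p1) (`]0%R, a] : set R) =
  (a `^ p^-1)%:E.
Proof.
move=> a0; rewrite /lebesgue_stieltjes_measure/= /measure_extension/=.
rewrite measurable_mu_extE//; last exact: is_ocitv.
rewrite [LHS](wlength_itv_bnd _ _ _ a0) /= !root_funE// powR0 ?subr0//.
by rewrite invr_eq0 gt_eqF// (lt_trans _ p1).
Qed.

(** The root function has no jump at a, so the endpoint does not count. *)
Lemma stieltjes_root_itvo p (p1 : 1 < p) (a : R) : 0 <= a ->
  lebesgue_stieltjes_measure (root_fun p1) (`]0%R, a[ : set R) =
  (a `^ p^-1)%:E.
Proof.
move=> a0; have p0 : 0 < p by rewrite (lt_trans _ p1).
apply/eqP; rewrite eq_le; apply/andP; split.
  rewrite -(stieltjes_root_itv p1 a0) le_measure ?inE//.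
  by apply: subitvPr; rewrite bnd_simp.
apply/lee_addgt0Pr => e e0.
have [ae|ea] := leP (a `^ p^-1) e.
  by rewrite (@le_trans _ _ e%:E) ?lee_fin// leeDr.
(* b < a is the point whose p-th root is e below that of a. *)
pose b := (a `^ p^-1 - e) `^ p.
have be : 0 <= a `^ p^-1 - e by rewrite subr_ge0 ltW.
have ba : b < a.
  rewrite -[ltRHS](powRVK p0)// gt0_ltr_powR// ?nnegrE ?powR_ge0//.
  by rewrite ltrBlDr ltrDl.
rewrite -leeBlDr// -EFinB -[(_ - e)%R](powRKV p0)// -/b.
rewrite -(stieltjes_root_itv p1) ?powR_ge0// le_measure ?inE//.
by apply: subset_itvl; rewrite bnd_simp.
Qed.

End root_function.

Section norms_by_tail.
Context d (T : measurableType d) (R : realType) (P : probability T R).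
Variable g : T -> \bar R.
Hypothesis mg : measurable_fun setT g.
Implicit Types (y t p : R).

Lemma int_rearrangement t : 0 <= t ->
  (\int[lebesgue_measure]_(s in `]0%R, t]) rearrangement P g s =
   \int[lebesgue_measure]_(y in `[0%R, +oo[) (Num.min (tail P g y) t)%:E)%E.
Proof.
move=> t0; rewrite (ge0_layer_cake (@lebesgue_measure R))//; last 2 first.
- exact: measurable_rearrangement.
- by move=> s _; exact: rearrangement_ge0.
apply: eq_integral => y; rewrite inE/= in_itv/= andbT => y0.
have a0 := tail_ge0 P g y; set a := tail P g y in a0 *.
have -> : [set s | (y%:E < rearrangement P g s)%E] = [set s | s < a].
  by apply/seteqP; split => s /=; rewrite lt_rearrangement.
have [at_|ta] := leP a t.
  rewrite (_ : _ `&` _ = `]0, a[%classic); last first.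
    apply/seteqP; split => s /=; rewrite !in_itv/=; first by move=> [/andP[-> _] ->].
    by move=> /andP[-> sa]; rewrite sa (ltW (lt_le_trans sa at_)).
  exact: lebesgue_measure_itv0.
rewrite (_ : _ `&` _ = `]0, t]%classic); last first.
  apply/seteqP; split => s /=; rewrite !in_itv/=; first by case.
  by move=> /andP[-> st]; rewrite st (le_lt_trans st ta).
exact: lebesgue_measure_itv0.
Qed.

(** The layers of the p-th powers are compared at the level y^(1/p). *)
Lemma Lp_rearrangement p : 0 < p ->
  Lp_norm p (rearrangement P g) = ((\int[P]_x (`|g x| `^ p)) `^ p^-1)%E.
Proof.
move=> p0; rewrite /Lp_norm unlock /=; congr (poweR _ _).
have mr : measurable_fun [set: measurableTypeR R] (rearrangement P g).
  exact: measurable_rearrangement.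
rewrite (ge0_layer_cake (@lebesgue01 R))//; last 2 first.
- by apply: (measurableT_comp (measurable_poweR _)); exact: measurableT_comp.
- by move=> *; exact: poweR_ge0.
rewrite (ge0_layer_cake P)//; last 2 first.
- by apply: (measurableT_comp (measurable_poweR _)); exact: measurableT_comp.
- by move=> *; exact: poweR_ge0.
apply: eq_integral => y; rewrite inE/= in_itv/= andbT => y0.
rewrite !setTI.
transitivity (P [set x | ((y `^ p^-1)%:E < `|g x|)%E]).
  rewrite -lebesgue01_rearrangement ?powR_ge0//; congr (lebesgue01 _).
  by apply/seteqP; split => s /=; rewrite lt_poweR.
by congr (P _); apply/seteqP; split => s /=; rewrite lt_poweR.
Qed.

Lemma lorentz_int_rearrangement p (p1 : 1 < p) :
  (\int[lebesgue_stieltjes_measure (root_fun p1)]_(s in `]0%R, 1%R])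
     rearrangement P g s =
   \int[lebesgue_measure]_(y in `[0%R, +oo[) (tail P g y `^ p^-1)%:E)%E.
Proof.
rewrite (ge0_layer_cake (lebesgue_stieltjes_measure (root_fun p1)))//; last 2 first.
- exact: measurable_rearrangement.
- by move=> s _; exact: rearrangement_ge0.
apply: eq_integral => y; rewrite inE/= in_itv/= andbT => y0.
rewrite -(stieltjes_root_itvo p1) ?tail_ge0//; congr (lebesgue_stieltjes_measure _ _).
apply/seteqP; split => s /=; rewrite !in_itv/= lt_rearrangement//.
  by move=> [/andP[-> _] ->].
move=> /andP[-> sa]; split => //=.
by rewrite (le_trans (ltW sa))// tail_le1.
Qed.

End norms_by_tail.

(** * The product measure and the Kruglov operator *)

Lemma nneseries_le_ub (R : realType) (u : nat -> \bar R) (M : \bar R) :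
  (forall k, 0 <= u k)%E -> (forall n, \sum_(0 <= k < n) u k <= M)%E ->
  (\sum_(k <oo) u k <= M)%E.
Proof.
move=> u0 uM; apply: lime_le; first exact: is_cvg_nneseries.
by apply: nearW => n; exact: uM.
Qed.

Section product_measure.
Variables (R : realType) (P : probability (seq_space R) R).
Hypothesis HP : is_product01 P.

Lemma measurable_coord n :
  measurable_fun setT (fun w : seq_space R => w n : measurableTypeR R).
Proof.
move=> _ A mA; rewrite setTI; apply: sub_sigma_algebra.
by exists n, A.
Qed.

Lemma coord0_measure (A : set R) : measurable A ->
  P [set w | A (w 0%N)] = lebesgue01 A.
Proof.
move=> mA; have := HP 1 (A := fun=> A) (fun=> mA).
rewrite big_ord_recl big_ord0 mule1 => <-; congr (P _).
apply/seteqP; split => w /=; last exact.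
by move=> Aw i; rewrite ltnS leqn0 => /eqP ->.
Qed.

Lemma coord_pair_measure k (A C : set R) : measurable A -> measurable C ->
  P [set w | A (w 0%N) /\ C (w k.+1)] = (lebesgue01 A * lebesgue01 C)%E.
Proof.
move=> mA mC.
pose D i := if i == 0%N then A else if i == k.+1 then C else setT.
have mD i : measurable (D i) by rewrite /D; case: ifP => // _; case: ifP.
have := HP k.+2 mD; rewrite big_ord_recl big_ord_recr /= big1 ?mul1e; last first.
  move=> i _; rewrite /D/= /bump/= add1n eqSS ltn_eqF//.
  exact: lebesgue01_setT.
rewrite /D/= /bump/= add1n eqxx => <-; congr (P _).
apply/seteqP; split => w /=.
  move=> [Aw Cw] i ik; case: ifPn => [/eqP->//|_]; case: ifPn => [/eqP->//|//].
by move=> h; split; [have := h 0%N isT|have := h k.+1 (ltnSn _)]; rewrite /= ?eqxx.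
Qed.

(** For z >= 0 the layer {1_A(w_0) phi(w_(k+1)) > z} is the rectangle where
    w_0 is in A and phi(w_(k+1)) > z, whose probability is a product. *)
Lemma coord_integral k (A : set R) (phi : R -> R) : measurable A ->
  measurable_fun setT phi -> (forall x, 0 <= phi x) ->
  (\int[P]_w (\1_A (w 0%N) * phi (w k.+1))%:E =
   lebesgue01 A * \int[lebesgue01]_x (phi x)%:E)%E.
Proof.
move=> mA mphi phi0.
have mh : measurable_fun [set: seq_space R]
    (fun w => (\1_A (w 0%N) * phi (w k.+1))%:E).
  apply/measurable_EFinP; apply: measurable_funM.
    exact: (measurableT_comp (measurable_indic _) (measurable_coord 0)).
  exact: (measurableT_comp mphi (measurable_coord _)).
rewrite (ge0_layer_cake P)//; last by move=> w _; rewrite lee_fin mulr_ge0.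
rewrite (ge0_layer_cake (@lebesgue01 R))//; last 2 first.
- exact/measurable_EFinP.
- by move=> w _; rewrite lee_fin.
have mset (z : R) : measurable [set x : R | (z%:E < (phi x)%:E)%E].
  rewrite -[X in measurable X]setTI; apply: emeasurable_fun_o_infty => //.
  exact/measurable_EFinP.
have A01 : (0 <= lebesgue01 A)%E by [].
rewrite -ge0_integralZl//; last first.
- apply: (eq_measurable_fun (fun z => (tail lebesgue01 (EFin \o phi) z)%:E)).
    move=> z; rewrite inE/= in_itv/= andbT => z0; rewrite setTI EFin_tail//; last first.
      exact/measurable_EFinP.
    by congr (lebesgue01 _); apply/seteqP; split => x /=; rewrite ger0_norm.
  apply/measurable_EFinP; apply: measurable_tail => //.
  exact/measurable_EFinP.
apply: eq_integral => z; rewrite inE/= in_itv/= andbT => z0.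
rewrite !setTI -(coord_pair_measure k)//; congr (P _); apply/seteqP; split => w /=.
  rewrite indicE; case: (boolP (w 0%N \in A)); rewrite ?inE.
    by rewrite mul1r => Aw zw; split.
  by rewrite mul0r lte_fin ltNge z0.
by move=> [Aw zw]; rewrite indicE mem_set// mul1r.
Qed.

End product_measure.

Section kruglov.
Variables (R : realType) (B : nat -> set R).
Hypothesis HB : kruglov_partition B.

Lemma kruglov_measurableB n : (0 < n)%N -> measurable (B n).
Proof. by case: HB => + _ _ _; exact. Qed.

Let partial (f : R -> R) N (w : seq_space R) :=
  \sum_(1 <= n < N) \sum_(1 <= k < n.+1) f (w k) * \1_(B n) (w 0%N).

Let partial_on f w n N : (0 < n)%N -> B n (w 0%N) -> (n < N)%N ->
  partial f N w = \sum_(k < n) f (w k.+1).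
Proof.
move=> n0 Bw nN; have tB m : (0 < m)%N -> m != n -> ~ B m (w 0%N).
  move=> m0 mn Bm; case: HB => _ _ /trivIsetP/(_ m n m0 n0 mn) + _.
  by rewrite -subset0 => /(_ (w 0%N)); apply.
rewrite /partial (bigD1_seq n) ?iota_uniq ?mem_index_iota ?n0//=.
rewrite [X in _ + X]big_seq_cond [X in _ + X]big1 ?addr0; last first.
  move=> m /andP[]; rewrite mem_index_iota => /andP[m0 _] mn.
  by rewrite big1// => k _; rewrite indicE memNset ?mulr0//; exact: tB.
under eq_bigr do rewrite indicE mem_set// mulr1.
by rewrite big_add1 big_mkord.
Qed.

Let partial_off f w N : (forall n, (0 < n)%N -> ~ B n (w 0%N)) ->
  partial f N w = 0.
Proof.
move=> nB; rewrite /partial big_seq_cond big1// => m /andP[].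
rewrite mem_index_iota => /andP[m0 _] _.
by rewrite big1// => k _; rewrite indicE memNset ?mulr0//; exact: nB.
Qed.

Lemma kruglov_on (f : R -> R) (w : seq_space R) n : (0 < n)%N -> B n (w 0%N) ->
  kruglov B f w = \sum_(k < n) f (w k.+1).
Proof.
by move=> n0 Bw; apply: lim_near_cst => //; exists n.+1 => // N; exact: partial_on.
Qed.

Lemma kruglov_off (f : R -> R) (w : seq_space R) :
  (forall n, (0 < n)%N -> ~ B n (w 0%N)) -> kruglov B f w = 0.
Proof.
by move=> nB; apply: lim_near_cst => //; apply: nearW => N; exact: partial_off.
Qed.

Lemma kruglov_dichotomy (w : seq_space R) :
  (exists2 n, (0 < n)%N & B n (w 0%N)) \/
  (forall n, (0 < n)%N -> ~ B n (w 0%N)).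
Proof.
have [[n n0 Bn]|nB] := pselect (exists2 n, (0 < n)%N & B n (w 0%N)).
  by left; exists n.
by right=> n n0 Bn; apply: nB; exists n.
Qed.

Lemma measurable_kruglov (f : R -> R) : measurable_fun setT f ->
  measurable_fun setT (kruglov B f).
Proof.
move=> mf; apply: (measurable_fun_cvg (h := partial f)).
- move=> N; rewrite [X in measurable_fun _ X](_ : _ = fun w : seq_space R =>
      \sum_(0 <= n < N.-1) \sum_(1 <= k < n.+2) f (w k) * \1_(B n.+1) (w 0%N));
    last by apply/funext => w; rewrite /partial big_add1.
  apply: measurable_sum => n; apply: measurable_sum => k; apply: measurable_funM.
    exact: (measurableT_comp mf (measurable_coord _)).
  apply: (measurableT_comp _ (measurable_coord 0)).
  by apply: measurable_indic; exact: (kruglov_measurableB (ltn0Sn n)).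
- move=> w _; apply: cvg_near_cst.
  have [[n n0 Bn]|nB] := kruglov_dichotomy w.
    by exists n.+1 => // N /= nN; rewrite (kruglov_on f n0 Bn) (partial_on _ n0 Bn).
  by apply: nearW => N; rewrite kruglov_off// partial_off.
Qed.

(** The index is shifted: in the notation of the introduction this is the event
    N >= k + 1, on which coordinate k + 1 occurs in the sum. *)
Definition at_least k : set R := \bigcup_i B (k.+1 + i)%N.

Lemma measurable_at_least k : measurable (at_least k).
Proof. by apply: bigcupT_measurable => i; exact: kruglov_measurableB. Qed.

Lemma at_leastP k n x : (0 < n)%N -> B n x -> (k < n)%N -> at_least k x.
Proof. by move=> n0 Bx kn; exists (n - k.+1)%N => //; rewrite subnKC. Qed.

Lemma lebesgue01_B n : (0 < n)%N ->
  lebesgue01 (B n) = ((expR 1 * n`!%:R)^-1)%:E.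
Proof.
move=> n0; case: HB => _ sB _ <-//; rewrite /lebesgue01 /mrestr setIidl//.
exact: sB.
Qed.

Lemma sum_invfact_le (n : nat) : \sum_(0 <= i < n) (i`!%:R)^-1 <= expR 1 :> R.
Proof.
have -> : \sum_(0 <= i < n) (i`!%:R)^-1 = series (exp_coeff 1) n :> R.
  by apply: eq_bigr => i _; rewrite /exp_coeff/= expr1n mul1r.
apply: nondecreasing_cvgn_le; last exact: is_cvg_series_exp_coeff.
apply/nondecreasing_series => i _ _; exact: exp_coeff_ge0.
Qed.

(** Since (m + i)! >= m! i!, the probability that a Poisson variable is at
    least m is at most 1/m!. *)
Lemma lebesgue01_at_least k : (lebesgue01 (at_least k) <= ((k.+1)`!%:R^-1)%:E)%E.
Proof.
have mB i : measurable (B (k.+1 + i)%N) by exact: kruglov_measurableB.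
apply: (@le_trans _ _ (\sum_(i <oo) lebesgue01 (B (k.+1 + i)%N))%E).
  by apply: measure_sigma_subadditive => //; exact: measurable_at_least.
apply: nneseries_le_ub => // n.
under eq_bigr do rewrite lebesgue01_B//.
rewrite sumEFin lee_fin.
apply: (@le_trans _ _ (((k.+1)`!%:R)^-1 * (expR 1)^-1 *
    \sum_(0 <= i < n) (i`!%:R)^-1)).
  rewrite mulr_sumr; apply: ler_sum => i _.
  rewrite -!invfM lef_pV2 ?posrE ?mulr_gt0 ?expR_gt0 ?ltr0n ?fact_gt0//.
  rewrite [leLHS](_ : _ = expR 1 * (k.+1`! * i`!)%:R); last first.
    by rewrite natrM; ring.
  rewrite ler_pM2l ?expR_gt0// ler_nat.
  rewrite -(bin_fact (leq_addr i k.+1)) addKn leq_pmull// bin_gt0.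
  exact: leq_addr.
by rewrite -mulrA ger_pMr ?invr_gt0 ?ltr0n ?fact_gt0// ler_pdivrMl ?expR_gt0//
  mulr1 sum_invfact_le.
Qed.

End kruglov.

(** * The variational formula for truncated tails *)

Lemma integral_itv0y_split (R : realType) (F : R -> \bar R) (y : R) : 0 <= y ->
  measurable_fun setT F -> (forall z, 0 <= F z)%E ->
  (\int[lebesgue_measure]_(z in `[0%R, +oo[) F z =
   \int[lebesgue_measure]_(z in `[0%R, y[) F z +
   \int[lebesgue_measure]_(z in `[y, +oo[) F z)%E.
Proof.
move=> y0 mF F0; rewrite -ge0_integral_setU//; last 2 first.
- exact: measurable_funTS.
- apply/disj_set2P; rewrite -subset0 => z /=.
  by rewrite !in_itv/= andbT => -[/andP[_ zy]]; rewrite leNgt zy.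
congr (integral _ _ _); apply/seteqP; split => z /=; rewrite !in_itv/= !andbT.
  by move=> z0; case: (ltP z y) => zy; [left; rewrite z0|right].
by move=> [/andP[]//|]; exact: le_trans.
Qed.

Section truncated_tail.
Context d (T : measurableType d) (R : realType) (P : probability T R).
Variable g : T -> \bar R.
Hypothesis mg : measurable_fun setT g.
Local Notation leb := (@lebesgue_measure R).

Lemma measurable_min_tail (c t : R) (D : set R) : measurable D ->
  measurable_fun D (fun z => (Num.min (c * tail P g z) t)%:E).
Proof.
move=> mD; apply/measurable_EFinP; apply: measurable_minr => //.
by apply: measurable_funM => //; exact: measurable_tail.
Qed.

Lemma measurable_min_tail1 (t : R) (D : set R) : measurable D ->
  measurable_fun D (fun z => (Num.min (tail P g z) t)%:E).
Proof.
move=> mD; apply: (eq_measurable_fun (fun z => (Num.min (1 * tail P g z) t)%:E)).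
  by move=> z _; rewrite mul1r.
exact: measurable_min_tail.
Qed.

Lemma integral_excess (y : R) :
  (\int[P]_x maxe (`|g x| - y%:E) 0 =
   \int[leb]_(z in `[y, +oo[) (tail P g z)%:E)%E.
Proof.
rewrite layer_cake//; last exact: measurableT_comp.
by apply: eq_integral => z _; rewrite EFin_tail.
Qed.

(** The integral over z of min (tail z) t is the integral of the rearrangement
    over [0,t]. Its layers below the height Y contribute at most t each, and the
    layers above Y add up to the integral of the excess of g over Y, which is at
    most H. *)
Lemma min_tail_le (Y t : R) (H : T -> \bar R) : 0 <= Y -> 0 <= t ->
  measurable_fun setT H -> (forall x, 0 <= H x)%E ->
  (forall x, `|g x| <= Y%:E + H x)%E ->
  (\int[leb]_(z in `[0%R, +oo[) (Num.min (tail P g z) t)%:E <=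
   (t * Y)%:E + \int[P]_x H x)%E.
Proof.
move=> Y0 t0 mH H0 gYH.
have mm := measurable_min_tail1 t.
have m0 z : (0 <= (Num.min (tail P g z) t)%:E)%E.
  by rewrite lee_fin le_min tail_ge0.
rewrite (integral_itv0y_split Y0)//; last exact: mm.
apply: leeD.
  apply: (@le_trans _ _ (\int[leb]_(z in `[0%R, Y[) (cst t%:E z))%E).
    apply: ge0_le_integral => //; [exact: mm|].
    by move=> z _; rewrite lee_fin ge_min lexx orbT.
  by rewrite integral_cst//= lebesgue_measure_itv0.
apply: (@le_trans _ _ (\int[leb]_(z in `[Y, +oo[) (tail P g z)%:E)%E).
  apply: ge0_le_integral => //; [exact: mm| |].
    by apply/measurable_EFinP; exact: measurable_tail.
  by move=> z _; rewrite lee_fin ge_min lexx.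
have mag : measurable_fun setT (fun x => `|g x|%E) by exact: measurableT_comp.
rewrite -integral_excess; apply: ge0_le_integral => //.
- by move=> x _; rewrite le_max lexx orbT.
- by apply: measurable_maxe => //; apply: emeasurable_funB.
- by move=> x _; rewrite ge_max H0 andbT leeBlDl.
Qed.

(** Conversely, the bound of [min_tail_le] is attained when the cut is made at
    the level y where c times the tail crosses t, which is the value of the
    rearrangement at t / c. When c <= t there is nothing to cut. *)
Lemma min_tail_ge (c t : R) : 0 < c -> 0 < t -> exists y : R,
  [/\ 0 <= y, (c <= t -> y = 0) &
  ((t * y)%:E + c%:E * \int[P]_x maxe (`|g x| - y%:E) 0 <=
   \int[leb]_(z in `[0%R, +oo[) (Num.min (c * tail P g z) t)%:E)%E].
Proof.
move=> c0 t0.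
have mag : measurable_fun setT (fun x => `|g x|%E) by exact: measurableT_comp.
have m0 z : (0 <= (Num.min (c * tail P g z) t)%:E)%E.
  by rewrite lee_fin le_min mulr_ge0 ?tail_ge0 ?ltW.
have mm := @measurable_min_tail c t _ measurableT.
have upper y : (forall z, y <= z -> c * tail P g z <= t) ->
    (c%:E * \int[P]_x maxe (`|g x| - y%:E) 0 =
     \int[leb]_(z in `[y, +oo[) (Num.min (c * tail P g z) t)%:E)%E.
  move=> yt; rewrite integral_excess -ge0_integralZl//; last 3 first.
  - by apply/measurable_EFinP; exact: measurable_tail.
  - by move=> *; rewrite lee_fin tail_ge0.
  - by rewrite lee_fin ltW.
  apply: eq_integral => z; rewrite inE/= in_itv/= andbT => yz.
  by rewrite min_l ?yt.
have [ct|tc] := leP c t.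
  exists 0; split => //; rewrite mulr0 add0e upper// => z _.
  by rewrite (le_trans _ ct)// ler_piMr ?tail_le1// ltW.
have crossing z : 0 <= z ->
    (z%:E < rearrangement P g (t / c))%E = (t < c * tail P g z).
  by move=> z0; rewrite lt_rearrangement// ltr_pdivrMr// mulrC.
have := rearrangement_ge0 P g (t / c).
move E : (rearrangement P g (t / c)) crossing => [y| |]//= crossing.
- rewrite lee_fin => y0; exists y; split => //.
  rewrite upper; last first.
    move=> z yz; rewrite leNgt -crossing ?(le_trans y0)//.
    by rewrite lte_fin -leNgt.
  rewrite [leRHS](integral_itv0y_split y0)//; apply: leeD => //.
  rewrite (@eq_integral _ _ _ _ _ (cst t%:E)); last first.
    move=> z; rewrite inE/= in_itv/= => /andP[z0 zy].
    by rewrite min_r// ltW// -crossing.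
  by rewrite integral_cst//= lebesgue_measure_itv0.
- move=> _; exists 0; split => //.
  rewrite [leRHS](_ : _ = +oo%E) ?leey//.
  rewrite (@eq_integral _ _ _ _ _ (cst t%:E)); last first.
    move=> z; rewrite inE/= in_itv/= andbT => z0.
    by rewrite min_r// ltW// -crossing// ltry.
  by rewrite integral_cst//= lebesgue_measure_itv/= ltry gt0_muley// lte_fin.
Qed.

End truncated_tail.

(** * The triangle inequality for the Kruglov operator *)

(** The bound of [lebesgue01_at_least], with the same shift of the index. *)
Definition invfact {R : realType} (k : nat) : R := (k.+1)`!%:R^-1.

Lemma invfact_gt0 {R : realType} k : 0 < invfact k :> R.
Proof. by rewrite invr_gt0 ltr0n fact_gt0. Qed.

Lemma invfact_le {R : realType} (t : R) : 0 < t ->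
  exists M, forall k, (M <= k)%N -> invfact k <= t.
Proof.
move=> t0; exists (Num.bound t^-1) => k Mk.
rewrite /invfact invf_ple ?posrE ?ltr0n ?fact_gt0//.
apply: le_trans (ltW (archi_boundP _)) _; first by rewrite invr_ge0 ltW.
by rewrite ler_nat (leq_trans Mk)// (leq_trans (leqnSn k))// fact_geq.
Qed.

Section kruglov_domination.
Variables (R : realType) (P : probability (seq_space R) R) (B : nat -> set R).
Hypotheses (HP : is_product01 P) (HB : kruglov_partition B).
Variable f : R -> R.
Hypothesis mf : measurable_fun setT f.
Local Notation leb := (@lebesgue_measure R).

(** This regroups the double sum defining the operator by coordinates:
    coordinate k + 1 contributes on the event [at_least B k]. *)
Lemma kruglov_le (w : seq_space R) (a : nat -> R) :
  (forall k, at_least B k (w 0%N) -> `|f (w k.+1)| <= a k) ->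
  exists n, `|kruglov B f w| <= \sum_(k < n) a k /\
    (forall k, (k < n)%N -> at_least B k (w 0%N)).
Proof.
move=> fa; have [[n n0 Bn]|nB] := kruglov_dichotomy B w; last first.
  by exists 0%N; rewrite kruglov_off// normr0 big_ord0.
have al k : (k < n)%N -> at_least B k (w 0%N) by exact: at_leastP.
exists n; split => //; rewrite (kruglov_on HB f n0 Bn).
by rewrite (le_trans (ler_norm_sum _ _ _))// ler_sum// => k _; exact/fa/al.
Qed.

Lemma measurable_summand k (phi : R -> R) : measurable_fun setT phi ->
  measurable_fun setT
    (fun w : seq_space R => (\1_(at_least B k) (w 0%N) * phi (w k.+1))%:E).
Proof.
move=> mphi; apply/measurable_EFinP; apply: measurable_funM.
  apply: (measurableT_comp _ (measurable_coord 0)).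
  by apply: measurable_indic; exact: measurable_at_least.
exact: (measurableT_comp mphi (measurable_coord _)).
Qed.

Lemma integral_summand_le k (phi : R -> R) : measurable_fun setT phi ->
  (forall x, 0 <= phi x) ->
  (\int[P]_w (\1_(at_least B k) (w 0%N) * phi (w k.+1))%:E <=
   (invfact k)%:E * \int[lebesgue01]_x (phi x)%:E)%E.
Proof.
move=> mphi phi0; rewrite (coord_integral HP)//; last exact: measurable_at_least.
apply: lee_wpmul2r; last exact: lebesgue01_at_least.
by apply: integral_ge0 => x _; rewrite lee_fin.
Qed.

(** Let K f = sum_k g_k, where g_k is the part carried by coordinate k + 1.
    Cutting each g_k at its own optimal level y_k, given by [min_tail_ge], the
    sum is at most the sum of the y_k plus the sum of the excesses. All but
    finitely many of the y_k vanish because 1/k! tends to 0, so the first sum is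
    finite and [min_tail_le] applies to K f. *)
Lemma kruglov_min_tail (t : R) : 0 < t ->
  (\int[leb]_(z in `[0%R, +oo[)
     (Num.min (tail P (EFin \o kruglov B f) z) t)%:E <=
   \sum_(k <oo) \int[leb]_(z in `[0%R, +oo[)
     (Num.min (invfact k * tail lebesgue01 (EFin \o f) z) t)%:E)%E.
Proof.
move=> t0; have mef : measurable_fun setT (EFin \o f) by exact/measurable_EFinP.
have /choice[y yP] := fun k => min_tail_ge (@lebesgue01 R) mef (invfact_gt0 k) t0.
have y0 k : 0 <= y k by have [] := yP k.
have [M yM] : exists M, forall k, (M <= k)%N -> y k = 0.
  by have [M hM] := invfact_le t0; exists M => k /hM; have [_ + _] := yP k.
have sumy n : \sum_(k < n) y k <= \sum_(k < M) y k.
  apply: (@le_trans _ _ (\sum_(k < M + n) y k)).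
    rewrite -!(big_mkord xpredT y) addnC [leRHS](big_cat_nat (n := n))//= ?leq_addr//.
    by rewrite lerDl sumr_ge0.
  rewrite -!(big_mkord xpredT y) [leLHS](big_cat_nat (n := M))//= ?leq_addr//.
  by rewrite [X in _ + X]big_nat_cond [X in _ + X]big1 ?addr0// => k /andP[/andP[/yM]].
pose phi k x := Num.max (`|f x| - y k) 0.
have mphi k : measurable_fun setT (phi k).
  apply: measurable_maxr => //; apply: measurable_funB => //.
  exact: measurableT_comp.
have phi0 k x : 0 <= phi k x by rewrite le_max lexx orbT.
pose h k (w : seq_space R) := (\1_(at_least B k) (w 0%N) * phi k (w k.+1))%:E.
have h0 k w : (0 <= h k w)%E by rewrite lee_fin mulr_ge0.
pose Y := \sum_(k < M) y k.
have Y0 : 0 <= Y by exact: sumr_ge0.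
have mH : measurable_fun setT (fun w => \sum_(k <oo) h k w)%E.
  by apply: ge0_emeasurable_sum => k *; [exact: h0|exact: measurable_summand].
have bound w : (`|(EFin \o kruglov B f) w| <= Y%:E + \sum_(k <oo) h k w)%E.
  have [|n [Kn al]] := @kruglov_le w (fun k => y k + phi k (w k.+1)).
    by move=> k _; rewrite -lerBlDl le_max lexx.
  apply: (@le_trans _ _ (\sum_(k < n) y k + \sum_(k < n) phi k (w k.+1))%:E).
    by rewrite /= lee_fin -big_split.
  rewrite EFinD leeD ?lee_fin ?sumy//.
  apply: le_trans (nneseries_lim_ge n _) => //.
  rewrite big_mkord -sumEFin lee_sum// => k _.
  rewrite /h indicE mem_set; last exact/al/ltn_ord.
  by rewrite mul1r.
apply: (le_trans (min_tail_le P _ Y0 (ltW t0) mH _ bound)).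
- by apply/measurable_EFinP; exact: measurable_kruglov.
- by move=> w; apply: nneseries_ge0 => *; exact: h0.
rewrite integral_nneseries//; last by move=> k; exact: measurable_summand.
have I0 k : (0 <= (invfact k)%:E *
    \int[lebesgue01]_x maxe (`|(EFin \o f) x| - (y k)%:E) 0)%E.
  apply: mule_ge0; first by rewrite lee_fin ltW ?invfact_gt0.
  apply: integral_ge0 => x _.
  by rewrite le_max lexx orbT.
have ty0 k : (0 <= (t * y k)%:E)%E by rewrite lee_fin mulr_ge0// ltW.
apply: (@le_trans _ _ (\sum_(k <oo) ((t * y k)%:E + (invfact k)%:E *
    \int[lebesgue01]_x maxe (`|(EFin \o f) x| - (y k)%:E) 0))%E); last first.
  apply: lee_nneseries => k; last by have [] := yP k.
  by move=> _ _; exact: adde_ge0.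
rewrite [leRHS]nneseriesD//.
apply: leeD.
  apply: le_trans (nneseries_lim_ge M _); last by [].
  by rewrite big_mkord sumEFin mulr_sumr.
apply: lee_nneseries => k.
  by move=> *; exact: integral_ge0.
move=> _; rewrite /h; apply: le_trans (integral_summand_le _ (mphi k) _) _ => //.
apply: lee_wpmul2l; first by rewrite lee_fin ltW ?invfact_gt0.
rewrite le_eqVlt; apply/orP; left; apply/eqP.
by apply: eq_integral => x _; rewrite EFin_max.
Qed.

End kruglov_domination.

(** * The sum of the roots of the inverse factorials *)

Section poisson_sum.
Variable R : realType.
Implicit Types p x : R.

Lemma sum_geometric_le x n : 0 < x -> x < 1 ->
  \sum_(0 <= k < n) x ^+ k.+1 <= x / (1 - x).
Proof.
move=> x0 x1; have x1' : 0 < 1 - x by rewrite subr_gt0.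
rewrite ler_pdivlMr//.
suff -> : (\sum_(0 <= k < n) x ^+ k.+1) * (1 - x) = x - x ^+ n.+1.
  by rewrite lerBlDr lerDl exprn_ge0// ltW.
elim: n => [|n IH]; first by rewrite big_geq// mul0r expr1 subrr.
by rewrite big_nat_recr//= mulrDl IH !exprS; ring.
Qed.

Definition poisson_bound p : R := 2 * expR 2 * (p / ln (p + 1)).

Lemma ln1p_gt0 p : 1 < p -> 0 < ln (p + 1).
Proof. by move=> p1; apply: ln_gt0; rewrite ltrDr (lt_trans _ p1). Qed.

Lemma poisson_bound_gt0 p : 1 < p -> 0 < poisson_bound p.
Proof.
move=> p1; apply: mulr_gt0; first by rewrite mulr_gt0 ?expR_gt0.
by rewrite divr_gt0 ?ln1p_gt0// (lt_trans _ p1).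
Qed.

(** k! e^y >= y^k for every y > 0; the choice y = sqrt (p + 1) turns the k-th
    summand into a constant times the k-th power of (p + 1)^(-1/(2p)). *)
Lemma sum_root_invfact p n : 1 < p ->
  \sum_(0 <= k < n) invfact k `^ p^-1 <= poisson_bound p.
Proof.
move=> p1; have p0 : 0 < p by rewrite (lt_trans _ p1).
have L0 := ln1p_gt0 p1; set L := ln (p + 1) in L0 *.
pose y := expR (L / 2); pose a := L / (2 * p).
have a0 : 0 < a by rewrite divr_gt0// mulr_gt0.
have y2p : y <= 2 * p.
  have : y ^+ 2 = p + 1.
    rewrite -expRM_natl mulrC divfK ?pnatr_eq0// lnK// posrE.
    by rewrite addr_gt0.
  by have := sqr_ge0 (y - 1); nra.
have term k : invfact k `^ p^-1 <= expR 2 * expR (- a) ^+ k.+1.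
  rewrite (@le_trans _ _ (expR (y - k.+1%:R * (L / 2)) `^ p^-1))//.
    apply: ge0_ler_powR;
      rewrite ?nnegrE ?expR_ge0 ?invr_ge0 ?(ltW p0) ?(ltW (invfact_gt0 _))//.
    rewrite expRB expRM_natl -/y ler_pdivlMr ?exprn_gt0 ?expR_gt0//.
    rewrite mulrC; apply: le_trans (expR_ge1Dxn k (expR_ge0 _)).
    by rewrite lerDr.
  rewrite -expRM mulrC -expRM_natl -expRD ler_expR mulrBr lerD//.
    by rewrite ler_pdivrMl// mulrC.
  rewrite le_eqVlt; apply/orP; left; apply/eqP; rewrite /a; field.
  by rewrite gt_eqF.
apply: (@le_trans _ _ (expR 2 * \sum_(0 <= k < n) expR (- a) ^+ k.+1)).
  by rewrite mulr_sumr ler_sum.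
have xa : expR (- a) * (1 + a) <= 1.
  by rewrite expRN ler_pdivrMl ?expR_gt0// mulr1 expR_ge1Dx.
have x1 : expR (- a) < 1 by rewrite expR_lt1 oppr_lt0.
rewrite /poisson_bound -/L [leRHS](_ : _ = expR 2 * a^-1); last first.
  by rewrite /a; field; rewrite !gt_eqF.
rewrite ler_pM2l ?expR_gt0// (le_trans (sum_geometric_le _ (expR_gt0 _) x1))//.
rewrite ler_pdivrMr ?subr_gt0// ler_pdivlMl//.
by move: xa; lra.
Qed.

Lemma nneseries_root_invfact p : 1 < p ->
  (\sum_(k <oo) (invfact k `^ p^-1)%:E <= (poisson_bound p)%:E)%E.
Proof.
move=> p1; apply: nneseries_le_ub => [k|n]; first by rewrite lee_fin powR_ge0.
by rewrite sumEFin lee_fin sum_root_invfact.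
Qed.

(** The tangent line of the p-th power at 1 lies below it; this is Young's
    inequality with second factor 1. *)
Lemma bernoulli_powR p (u : R) : 1 < p -> 0 <= u -> p * u - (p - 1) <= u `^ p.
Proof.
move=> p1 u0; have p0 : 0 < p by rewrite (lt_trans _ p1).
have q0 : 0 < 1 - p^-1 by rewrite subr_gt0 invf_lt1.
have /= := conjugate_powR (q := (1 - p^-1)^-1) u0 ler01 p0.
rewrite invr_gt0 q0 invrK => /(_ isT).
rewrite mulr1 powR1 mul1r => /(_ ltac:(ring)) h.
rewrite -(ler_pM2l p0) in h; move: h; rewrite mulrDr mulrCA mulfV ?gt_eqF// mulr1.
rewrite mulrBr mulr1 mulfV ?gt_eqF//; lra.
Qed.

(** Convexity with total weight at most 1: sum, with the weights theta_k, the
    tangent inequality for the numbers a_k / (theta_k s), where s is the sum of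
    the a_k. *)
Lemma powR_sum_le p n (a theta : nat -> R) : 1 < p ->
  (forall k, 0 <= a k) -> (forall k, 0 < theta k) ->
  \sum_(k < n) theta k <= 1 ->
  (\sum_(k < n) a k) `^ p <= \sum_(k < n) theta k * (a k / theta k) `^ p.
Proof.
move=> p1 a0 t0 t1; have p0 : 0 < p by rewrite (lt_trans _ p1).
set s := \sum_(k < n) a k.
have : 0 <= s by exact: sumr_ge0.
rewrite le_eqVlt => /predU1P[<-|s0].
  rewrite powR0 ?gt_eqF//; apply: sumr_ge0 => k _.
  by rewrite mulr_ge0 ?powR_ge0// ltW.
have sp0 : 0 < s `^ p by exact: powR_gt0.
apply: (@le_trans _ _ (\sum_(k < n) s `^ p * (p / s * a k - (p - 1) * theta k))).
  rewrite -mulr_sumr sumrB -!mulr_sumr -/s divfK ?gt_eqF//.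
  by rewrite ler_peMr ?(ltW sp0)//; move: t1 p1; nra.
apply: ler_sum => k _.
have -> : a k / theta k = s * (a k / (theta k * s)).
  by field; rewrite !gt_eqF.
rewrite powRM ?(ltW s0) ?divr_ge0 ?mulr_ge0 ?(ltW s0) ?(ltW (t0 _))//.
rewrite mulrCA ler_pM2l//.
have := @bernoulli_powR p (a k / (theta k * s)) p1.
rewrite divr_ge0 ?mulr_ge0 ?(ltW s0) ?(ltW (t0 _))// => /(_ isT) h.
rewrite -(ler_pM2l (t0 k)) in h; apply: le_trans h.
rewrite le_eqVlt; apply/orP; left; apply/eqP; field.
by rewrite !gt_eqF.
Qed.

End poisson_sum.

(** * Upper bounds in the Lebesgue and Marcinkiewicz spaces *)

Section lebesgue_marcinkiewicz_upper_bounds.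
Variables (R : realType) (P : probability (seq_space R) R) (B : nat -> set R).
Hypotheses (HP : is_product01 P) (HB : kruglov_partition B).
Variables (p : R) (p1 : 1 < p).
Variable f : R -> R.
Hypothesis mf : measurable_fun setT f.
Local Notation leb := (@lebesgue_measure R).
Local Notation psi := (root_fun p1).

Let p0 : 0 < p. Proof. by rewrite (lt_trans _ p1). Qed.
Let mef : measurable_fun setT (EFin \o f). Proof. exact/measurable_EFinP. Qed.
Let mK : measurable_fun setT (EFin \o kruglov B f).
Proof. by apply/measurable_EFinP; exact: measurable_kruglov. Qed.

(** Convexity with weights theta_k proportional to (1/(k+1)!)^(1/p): the k-th
    summand then contributes theta_k b^p, where b is the sum of these roots or
    any bound for it. *)
Lemma kruglov_Lp : (\int[lebesgue01]_x (`|f x| `^ p)%:E <= 1)%E ->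
  (\int[P]_w (`|kruglov B f w| `^ p)%:E <= (poisson_bound p `^ p)%:E)%E.
Proof.
move=> f1; have b0 := poisson_bound_gt0 p1; set b := poisson_bound p in b0 *.
pose theta k := invfact k `^ p^-1 / b.
have theta0 k : 0 < theta k by rewrite divr_gt0 ?powR_gt0 ?invfact_gt0.
have theta1 n : \sum_(k < n) theta k <= 1.
  rewrite -mulr_suml ler_pdivrMr// mul1r -(big_mkord xpredT (fun k => invfact k `^ p^-1)).
  exact: sum_root_invfact.
pose phi k x := theta k * (`|f x| / theta k) `^ p.
have mphi k : measurable_fun setT (phi k).
  apply: measurable_funM => //.
  apply: (@measurableT_comp _ _ _ _ _ _ (@powR R ^~ p)) => //.
  by apply: measurable_funM => //; exact: measurableT_comp.
have phi0 k x : 0 <= phi k x by rewrite mulr_ge0 ?powR_ge0// ltW.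
have mpow (d : measure_display) (T : measurableType d) (g : T -> R) :
    measurable_fun setT g -> measurable_fun setT (fun x => (`|g x| `^ p)%:E).
  move=> mg; apply/measurable_EFinP.
  apply: (@measurableT_comp _ _ _ _ _ _ (@powR R ^~ p)) => //.
  exact: measurableT_comp.
apply: (@le_trans _ _ (\int[P]_w (\sum_(k <oo)
    (\1_(at_least B k) (w 0%N) * phi k (w k.+1))%:E))%E).
  apply: ge0_le_integral => //.
  - by apply: mpow; exact: measurable_kruglov.
  - apply: ge0_emeasurable_sum => k *; last exact: measurable_summand.
    by rewrite lee_fin mulr_ge0.
  - move=> w _.
    have [//|n [Kn al]] := @kruglov_le _ _ HB f w (fun k => `|f (w k.+1)|).
    apply: (@le_trans _ _ (\sum_(k < n) phi k (w k.+1))%:E).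
      rewrite lee_fin; apply: le_trans
        (powR_sum_le (a := fun k => `|f (w k.+1)|) p1 _ theta0 (theta1 n)) => //.
      by rewrite ge0_ler_powR ?nnegrE ?(ltW p0) ?sumr_ge0.
    apply: le_trans (nneseries_lim_ge n _) => //; last first.
      by move=> *; rewrite lee_fin mulr_ge0.
    rewrite big_mkord -sumEFin lee_sum// => k _.
    rewrite indicE mem_set; last exact/al/ltn_ord.
    by rewrite mul1r.
rewrite integral_nneseries//; last 2 first.
- by move=> k; exact: measurable_summand.
- by move=> k w _; rewrite lee_fin mulr_ge0.
apply: (@le_trans _ _ (\sum_(k <oo) (theta k * b `^ p)%:E)%E); last first.
  apply: nneseries_le_ub => [k|n].
    by rewrite lee_fin mulr_ge0 ?powR_ge0// ltW.
  rewrite sumEFin lee_fin -mulr_suml big_mkord.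
  by rewrite ler_piMl ?powR_ge0.
apply: lee_nneseries => k.
  by move=> _ _; apply: integral_ge0 => w _; rewrite lee_fin mulr_ge0.
move=> _; apply: le_trans (integral_summand_le HP HB k (mphi k) (phi0 k)) _.
have -> : (\int[lebesgue01]_x (phi k x)%:E =
    (theta k * (theta k)^-1 `^ p)%:E * \int[lebesgue01]_x (`|f x| `^ p)%:E)%E.
  transitivity (\int[lebesgue01]_x
      ((theta k * (theta k)^-1 `^ p)%:E * (`|f x| `^ p)%:E))%E.
    apply: eq_integral => x _; rewrite -EFinM /phi powRM ?invr_ge0 ?(ltW (theta0 k))//.
    by congr EFin; ring.
  apply: ge0_integralZl => //; first exact: mpow.
  by rewrite lee_fin mulr_ge0 ?powR_ge0// ltW.
rewrite muleA -EFinM.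
apply: (@le_trans _ _ ((invfact k * (theta k * (theta k)^-1 `^ p))%:E * 1)%E).
  apply: lee_wpmul2l => //.
  rewrite lee_fin mulr_ge0 ?(ltW (invfact_gt0 k))//.
  by rewrite mulr_ge0 ?powR_ge0 ?(ltW (theta0 k)).
rewrite mule1 lee_fin mulrCA ler_pM2l//.
rewrite /theta invf_div powRM ?(ltW b0) ?invr_ge0 ?powR_ge0//.
have c0 : 0 < invfact k :> R by exact: invfact_gt0.
have -> : (invfact k `^ p^-1)^-1 `^ p = (invfact k)^-1.
  by rewrite -powR_inv1 ?powR_ge0// powRAC powRVK ?powR_inv1 ?(ltW c0).
by rewrite mulrCA mulfV ?mulr1 ?gt_eqF.
Qed.

Lemma Lp_upper : (Lp_norm p (EFin \o f) <= 1)%E ->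
  (Lp_norm p (rearrangement P (EFin \o kruglov B f)) <= (poisson_bound p)%:E)%E.
Proof.
move=> f1; rewrite Lp_rearrangement//=.
have : (\int[lebesgue01]_x (`|f x| `^ p)%:E <= 1)%E.
  have <- : (Lp_norm p (EFin \o f) `^ p = \int[lebesgue01]_x (`|f x| `^ p)%:E)%E.
    by rewrite /Lp_norm poweR_Lnorm ?gt_eqF.
  rewrite -(poweR1r p); apply: gt0_ler_poweR; rewrite ?(ltW p0)//.
    by rewrite in_itv/= leey Lnorm_ge0.
  by rewrite in_itv/= leey lee01.
move=> /kruglov_Lp h.
rewrite -[leRHS]poweRe1 ?lee_fin ?(ltW (poisson_bound_gt0 p1))//.
rewrite -[X in (_ <= _ `^ X)%E](mulfV (lt0r_neq0 p0)) poweRrM.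
have I0 : (0 <= \int[P]_x (`|kruglov B f x| `^ p)%:E)%E.
  by apply: integral_ge0 => w _; rewrite lee_fin powR_ge0.
by apply: gt0_ler_poweR; rewrite ?invr_ge0 ?(ltW p0)// in_itv/= leey andbT
  ?poweR_ge0 ?lee_fin ?powR_ge0.
Qed.

(** Multiplying the tail of f by c multiplies the Marcinkiewicz norm by at most
    c^(1/p). *)
Lemma marcinkiewicz_min_tail (c t : R) : 0 < c -> 0 < t ->
  (marcinkiewicz_norm psi (EFin \o f) <= 1)%E ->
  (\int[leb]_(z in `[0%R, +oo[)
     (Num.min (c * tail lebesgue01 (EFin \o f) z) t)%:E <=
   (c `^ p^-1 * (t / t `^ p^-1))%:E)%E.
Proof.
move=> c0 t0 f1.
(* The definition of the norm, at the point u. *)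
have norm u : 0 < u -> u <= 1 -> (\int[leb]_(z in `[0%R, +oo[)
     (Num.min (tail lebesgue01 (EFin \o f) z) u)%:E <= (u / u `^ p^-1)%:E)%E.
  move=> u0 u1; rewrite -int_rearrangement ?(ltW u0)//.
  have h : ((psi u / u)%:E * \int[leb]_(s in `]0%R, u])
      rearrangement lebesgue01 (EFin \o f) s <= 1)%E.
    apply: le_trans f1; apply: ereal_sup_ubound; exists u => //=.
    by rewrite in_itv/= u0.
  have r0 : 0 < u `^ p^-1 / u by rewrite divr_gt0 ?powR_gt0.
  move: h; rewrite root_funE ?(ltW u0)// -lee_pdivlMl// mule1.
  by rewrite invf_div.
have scale s : 0 < s -> s <= 1 ->
    (forall z, Num.min (c * tail lebesgue01 (EFin \o f) z) t =
       c * Num.min (tail lebesgue01 (EFin \o f) z) s) ->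
  (\int[leb]_(z in `[0%R, +oo[)
     (Num.min (c * tail lebesgue01 (EFin \o f) z) t)%:E <=
   (c * (s / s `^ p^-1))%:E)%E.
  move=> s0 s1 h; under eq_integral do rewrite h EFinM.
  rewrite ge0_integralZl//; last 3 first.
  - exact: measurable_min_tail1.
  - by move=> *; rewrite lee_fin le_min tail_ge0 ltW.
  - by rewrite lee_fin ltW.
  by rewrite EFinM; apply: lee_wpmul2l; [rewrite lee_fin ltW|exact: norm].
have [tc|ct] := leP t c.
  have tc0 : 0 < t / c by rewrite divr_gt0.
  apply: le_trans (scale (t / c) _ _ _) _ => //.
  - by rewrite ler_pdivrMr// mul1r.
  - by move=> z; rewrite minr_pMr ?(ltW c0)// (mulrC c (t / c)) divfK ?gt_eqF.
  rewrite lee_fin powRM ?invr_ge0 ?(ltW t0) ?(ltW c0)//.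
  have -> : c^-1 `^ p^-1 = (c `^ p^-1)^-1.
    by rewrite -(powR_inv1 (ltW c0)) powRAC powR_inv1 ?powR_ge0.
  rewrite le_eqVlt; apply/orP; left; apply/eqP; field.
  by rewrite !gt_eqF ?powR_gt0.
(* Beyond c the truncation at t is void, and t^(1-1/p) >= c^(1-1/p). *)
apply: le_trans (scale 1 _ _ _) _ => //.
- move=> z; rewrite !min_l ?tail_le1//.
  by rewrite (le_trans _ (ltW ct))// ler_piMr ?tail_le1// ltW.
rewrite powR1 invr1 !mulr1 lee_fin.
have quot x : 0 < x -> x / x `^ p^-1 = x `^ (1 - p^-1).
  move=> x0; rewrite powRB; last by rewrite (gt_eqF x0) implybT.
  by rewrite powRr1 ?(ltW x0).
rewrite -[leLHS](divfK (lt0r_neq0 (powR_gt0 p^-1 c0))) mulrC ler_pM2l ?powR_gt0//.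
rewrite !quot// ge0_ler_powR ?nnegrE ?(ltW c0) ?(ltW t0) ?(ltW ct)//.
by rewrite subr_ge0 invf_le1// ltW.
Qed.

(** [kruglov_min_tail] bounds the Marcinkiewicz norm of K f by the sum over k of
    the norms of functions whose tail is 1/(k+1)! times that of f. *)
Lemma marcinkiewicz_upper : (marcinkiewicz_norm psi (EFin \o f) <= 1)%E ->
  (marcinkiewicz_norm psi (rearrangement P (EFin \o kruglov B f)) <=
   (poisson_bound p)%:E)%E.
Proof.
move=> f1; apply: ge_ereal_sup => _ [t /= + <-].
rewrite in_itv/= => /andP[t0 t1].
rewrite rearrangement_idem// int_rearrangement ?(ltW t0)// root_funE ?(ltW t0)//.
have r0 : 0 < t `^ p^-1 / t by rewrite divr_gt0 ?powR_gt0.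
rewrite -lee_pdivlMl// -EFinM invf_div.
apply: (le_trans (kruglov_min_tail HP HB mf t0)).
apply: (@le_trans _ _ (\sum_(k <oo) (t / t `^ p^-1 * invfact k `^ p^-1)%:E)%E).
  apply: lee_nneseries => k.
    move=> _ _; apply: integral_ge0 => z _.
    by rewrite lee_fin le_min mulr_ge0 ?tail_ge0 ?ltW ?invfact_gt0.
  move=> _; rewrite (mulrC (t / _)).
  exact: (marcinkiewicz_min_tail (invfact_gt0 k)).
under eq_eseriesr do rewrite EFinM.
rewrite nneseriesZl; last by move=> *; rewrite lee_fin powR_ge0.
rewrite EFinM; apply: lee_wpmul2l; first by rewrite lee_fin divr_ge0 ?powR_ge0 ?ltW.
exact: nneseries_root_invfact.
Qed.

End lebesgue_marcinkiewicz_upper_bounds.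

(** * A dyadic equivalent of the root function *)

Section dyadic.
Variables (R : realType) (p : R) (p1 : 1 < p).

Definition halfroot : R := 2^-1 `^ p^-1.

(** These coefficients make [dyadic_root] homogeneous under halving in the same
    way as the p-th root, see [dyadic_root_half]. *)
Definition dyadic_coef (j : nat) : R :=
  if j is 0%N then 2 * halfroot / (2 * halfroot - 1) else (2 * halfroot) ^+ j.

Definition dyadic_root (s : R) : \bar R :=
  (\sum_(j <oo) (dyadic_coef j * Num.min s (2^-1 ^+ j))%:E)%E.

Let r := halfroot.
Let p0 : 0 < p. Proof. by rewrite (lt_trans _ p1). Qed.
Let r0 : 0 < r. Proof. by rewrite powR_gt0. Qed.

Lemma powR_half (s : R) : 0 <= s -> (2^-1 * s) `^ p^-1 = halfroot * s `^ p^-1.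
Proof. by move=> s0; rewrite powRM ?invr_ge0. Qed.

Let oneE : 1 `^ p^-1 = 1 :> R. Proof. by rewrite powR1. Qed.

Let r1 : r < 1.
Proof.
rewrite /r /halfroot -[ltRHS]oneE gt0_ltr_powR ?invr_gt0 ?nnegrE ?invr_ge0//.
by rewrite invf_lt1// ltr1n.
Qed.

(* For p = 1 this fails, and the geometric series summed by the coefficient of
   index 0 diverges. *)
Let r2 : 1 < 2 * r.
Proof.
rewrite -ltr_pdivrMl// mulr1 /r /halfroot.
have -> : 2^-1 `^ p^-1 = expR (p^-1 * ln 2^-1) :> R.
  by rewrite /powR gt_eqF// invr_gt0.
rewrite -[ltLHS]lnK ?posrE ?invr_gt0// ltr_expR.
have l0 : ln (2^-1 : R) < 0 by rewrite ln_lt0// invr_gt0 ltr0n/= invf_lt1 ?ltr1n.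
have q1 : p^-1 < 1 by rewrite invf_lt1.
by nra.
Qed.

Lemma dyadic_coef_ge0 j : 0 <= dyadic_coef j.
Proof.
case: j => [|j] /=; last by rewrite exprn_ge0// mulr_ge0 ?(ltW r0).
by rewrite divr_ge0 ?mulr_ge0 ?(ltW r0)// subr_ge0 ltW.
Qed.

Let half_ge0 j : 0 <= 2^-1 ^+ j :> R.
Proof. by rewrite exprn_ge0 ?invr_ge0. Qed.

Lemma dyadic_term_ge0 (s : R) j : 0 <= s ->
  0 <= dyadic_coef j * Num.min s (2^-1 ^+ j).
Proof. by move=> s0; rewrite mulr_ge0 ?dyadic_coef_ge0// le_min s0 half_ge0. Qed.

Lemma dyadic_root_ge0 (s : R) : 0 <= s -> (0 <= dyadic_root s)%E.
Proof. by move=> s0; apply: nneseries_ge0 => *; rewrite lee_fin dyadic_term_ge0. Qed.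

Lemma le_dyadic_root (s u : R) : 0 <= s -> s <= u ->
  (dyadic_root s <= dyadic_root u)%E.
Proof.
move=> s0 su; apply: lee_nneseries => j *; rewrite lee_fin ?dyadic_term_ge0//.
by rewrite ler_wpM2l ?dyadic_coef_ge0// le_min !ge_min lexx orbT andbT su.
Qed.

Let dyadic_rest (s : R) : \bar R :=
  (\sum_(j <oo) ((2 * r) ^+ j.+1 * Num.min s (2^-1 ^+ j.+1))%:E)%E.

Let rest_term_ge0 (s : R) j : 0 <= s ->
  0 <= (2 * r) ^+ j * Num.min s (2^-1 ^+ j).
Proof. by move=> s0; rewrite mulr_ge0 ?exprn_ge0 ?mulr_ge0 ?(ltW r0)// le_min s0 half_ge0. Qed.

Let dyadic_root_split (s : R) : 0 <= s -> s <= 1 ->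
  dyadic_root s = ((dyadic_coef 0 * s)%:E + dyadic_rest s)%E.
Proof.
move=> s0 s1; rewrite /dyadic_root nneseries_recl//; last first.
  by move=> *; rewrite lee_fin dyadic_term_ge0.
rewrite min_l//; congr (_ + _)%E; rewrite -nneseries_addn; last first.
  by move=> *; rewrite lee_fin dyadic_term_ge0.
by apply: eq_eseriesr => j _; rewrite addn1.
Qed.

Let dyadic_rest_half (s : R) : 0 <= s -> s <= 1 ->
  dyadic_rest (2^-1 * s) = (r%:E * (s%:E + dyadic_rest s))%E.
Proof.
move=> s0 s1.
have -> : (s%:E + dyadic_rest s =
    \sum_(j <oo) ((2 * r) ^+ j * Num.min s (2^-1 ^+ j))%:E)%E.
  rewrite [RHS]nneseries_recl//; last by move=> *; rewrite lee_fin rest_term_ge0.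
  rewrite !expr0 mul1r min_l//; congr (_ + _)%E.
  rewrite -[RHS]nneseries_addn; last by move=> *; rewrite lee_fin rest_term_ge0.
  by apply: eq_eseriesr => j _; rewrite addn1.
rewrite -nneseriesZl; last by move=> *; rewrite lee_fin rest_term_ge0.
apply: eq_eseriesr => j _; rewrite -EFinM !exprS -minr_pMr ?invr_ge0//.
by congr EFin; field.
Qed.

(** The coefficient of index 0 is the sum of the geometric series of all
    (2r)^j with j <= 0, so that halving s only shifts the indices: for s <= 1,
    min s 2^-j = s for each of those j. *)
Lemma dyadic_root_half (s : R) : 0 <= s -> s <= 1 ->
  dyadic_root (2^-1 * s) = (halfroot%:E * dyadic_root s)%E.
Proof.
move=> s0 s1; have h0 : 0 <= 2^-1 * s by rewrite mulr_ge0 ?invr_ge0.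
have h1 : 2^-1 * s <= 1 by move: s0 s1; lra.
rewrite !dyadic_root_split// dyadic_rest_half// -/r.
have G0 : (0 <= dyadic_rest s)%E.
  by apply: nneseries_ge0 => *; rewrite lee_fin rest_term_ge0.
have a0s : 0 <= dyadic_coef 0 * s by rewrite mulr_ge0 ?dyadic_coef_ge0.
rewrite ge0_muleDr ?lee_fin// [RHS]ge0_muleDr ?lee_fin//.
rewrite addeA -!EFinM -EFinD; congr (_%:E + _)%E.
rewrite /= -/r; field.
by rewrite subr_eq0 gt_eqF.
Qed.

Lemma dyadic_root1_fin : exists2 phi, 0 < phi & dyadic_root 1 = phi%:E.
Proof.
have := @dyadic_root_ge0 1 ler01.
have : (dyadic_root 1 <= (dyadic_coef 0 + r / (1 - r))%:E)%E.
  rewrite dyadic_root_split// mulr1 EFinD leeD//.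
  apply: nneseries_le_ub => [j|n]; first by rewrite lee_fin rest_term_ge0.
  rewrite sumEFin lee_fin; apply: le_trans (sum_geometric_le n r0 r1).
  apply: ler_sum => j _; rewrite -[leRHS](_ : (2 * r) ^+ j.+1 * 2^-1 ^+ j.+1 = _).
    by rewrite ler_wpM2l ?exprn_ge0 ?mulr_ge0 ?(ltW r0)// ge_min lexx orbT.
  by rewrite -exprMn; congr (_ ^+ _); field.
have : ((dyadic_coef 0)%:E <= dyadic_root 1)%E.
  rewrite dyadic_root_split// mulr1 leeDl//.
  by apply: nneseries_ge0 => *; rewrite lee_fin rest_term_ge0.
case: (dyadic_root 1) => [phi||]//.
rewrite lee_fin => h _ _; exists phi => //; apply: lt_le_trans h.
by rewrite divr_gt0 ?mulr_gt0// subr_gt0.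
Qed.

(** Up to the constant [dyadic_root 1], the p-th root is within a factor 2 of a
    positive combination of the functions min s 2^-j: both are multiplied by r
    when s is halved, and on [1/2,1] both are monotone and vary by a factor of
    1/r <= 2. *)
Lemma dyadic_root_equiv (s : R) : 0 <= s -> s <= 1 ->
  ((s `^ p^-1)%:E * dyadic_root 1 <= 2%:E * dyadic_root s)%E /\
  (dyadic_root s <= (2 * s `^ p^-1)%:E * dyadic_root 1)%E.
Proof.
have [phi phi0 E1] := dyadic_root1_fin.
have base u : 2^-1 <= u -> u <= 1 ->
  ((u `^ p^-1)%:E * dyadic_root 1 <= 2%:E * dyadic_root u)%E /\
  (dyadic_root u <= (2 * u `^ p^-1)%:E * dyadic_root 1)%E.
  move: u => {}s hs s1; have s0 : 0 <= s by rewrite (le_trans _ hs)// invr_ge0.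
  have rs : r <= s `^ p^-1.
    by rewrite /r /halfroot ge0_ler_powR ?invr_ge0 ?nnegrE ?(ltW p0) ?invr_ge0.
  have s1' : s `^ p^-1 <= 1.
    by rewrite -[leRHS]oneE ge0_ler_powR ?invr_ge0 ?nnegrE ?(ltW p0).
  split.
    apply: (@le_trans _ _ (2%:E * dyadic_root 2^-1)%E); last first.
      by apply: lee_wpmul2l => //; rewrite le_dyadic_root ?invr_ge0.
    have -> : (dyadic_root 2^-1 = r%:E * dyadic_root 1)%E.
      by rewrite -dyadic_root_half// mulr1.
    rewrite E1 -!EFinM lee_fin.
    by move: r2 phi0 s1'; nra.
  apply: (@le_trans _ _ (dyadic_root 1)); first exact: le_dyadic_root.
  rewrite E1 -EFinM lee_fin; by move: rs r2 phi0; nra.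
move=> + s1; rewrite le_eqVlt => /predU1P[<-|s0].
  rewrite powR0 ?invr_eq0 ?gt_eqF// mulr0 mul0e.
  have -> : dyadic_root 0 = 0%E.
    apply: eseries0 => j _ _; rewrite min_l ?mulr0//.
  by rewrite mule0.
have [m] : exists m, 2^-1 ^+ m <= s.
  exists (Num.bound s^-1); rewrite exprVn invf_ple ?posrE ?exprn_gt0//.
  apply: le_trans (ltW (archi_boundP _)) _; first by rewrite invr_ge0 ltW.
  by rewrite -natrX ler_nat ltnW// ltn_expl.
elim: m s s0 s1 => [|m IH] s s0 s1 ms.
  by apply: base => //; apply: le_trans ms; rewrite expr0 invf_le1 ?ler1n.
have [hs|sh] := leP 2^-1 s; first exact: base.
have s2 : s = 2^-1 * (2 * s) by field.
have s20 : 0 < 2 * s by rewrite mulr_gt0.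
have s21 : 2 * s <= 1 by move: sh; lra.
have [|lo up] := IH (2 * s) s20 s21; first by move: ms; rewrite exprS; lra.
have hr : (0 <= r%:E)%E by rewrite lee_fin ltW.
rewrite s2 dyadic_root_half ?(ltW s20)// powR_half ?(ltW s20)// -/r; split.
  by rewrite muleCA EFinM -muleA lee_wpmul2l.
by rewrite mulrCA EFinM -muleA lee_wpmul2l.
Qed.

End dyadic.

(** * Upper bound in the Lorentz space *)

Section lorentz_upper_bound.
Variables (R : realType) (P : probability (seq_space R) R) (B : nat -> set R).
Hypotheses (HP : is_product01 P) (HB : kruglov_partition B).
Variables (p : R) (p1 : 1 < p).
Variable f : R -> R.
Hypothesis mf : measurable_fun setT f.
Local Notation leb := (@lebesgue_measure R).
Local Notation psi := (root_fun p1).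

Let p0 : 0 < p. Proof. by rewrite (lt_trans _ p1). Qed.
Let mef : measurable_fun setT (EFin \o f). Proof. exact/measurable_EFinP. Qed.
Let mK : measurable_fun setT (EFin \o kruglov B f).
Proof. by apply/measurable_EFinP; exact: measurable_kruglov. Qed.

Let invfact_le1 k : invfact k <= 1 :> R.
Proof. by rewrite invf_le1 ?ler1n ?ltr0n fact_gt0. Qed.

(** For c = 1 this is the Lorentz norm, by [lorentz_int_rearrangement]; in
    general it is the norm of a function whose tail is c times that of g. *)
Let root_integral d (T : measurableType d) (Q : probability T R) (g : T -> R) (c : R) :=
  (\int[leb]_(z in `[0%R, +oo[) ((c * tail Q (EFin \o g) z) `^ p^-1)%:E)%E.

Let dyadic_integral d (T : measurableType d) (Q : probability T R) (g : T -> R) (c : R) :=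
  (\int[leb]_(z in `[0%R, +oo[) dyadic_root p (c * tail Q (EFin \o g) z))%E.

Section tail_integrals.
Context d (T : measurableType d) (Q : probability T R) (g : T -> R) (c : R).
Hypotheses (mg : measurable_fun setT g) (c0 : 0 <= c) (c1 : c <= 1).

Let meg : measurable_fun setT (EFin \o g). Proof. exact/measurable_EFinP. Qed.

Let mroot (D : set R) : measurable D ->
  measurable_fun D (fun z => ((c * tail Q (EFin \o g) z) `^ p^-1)%:E).
Proof.
move=> mD; apply/measurable_EFinP.
apply: (measurableT_comp (f := @powR R ^~ p^-1)) => //.
by apply: measurable_funM => //; exact: measurable_tail.
Qed.

Let ct0 z : 0 <= c * tail Q (EFin \o g) z.
Proof. by rewrite mulr_ge0 ?tail_ge0. Qed.

Let ct1 z : c * tail Q (EFin \o g) z <= 1.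
Proof. by rewrite mulr_ile1 ?tail_ge0 ?tail_le1. Qed.

Let mterm j : measurable_fun (`[0, +oo[ : set R)
  (fun z => (dyadic_coef p j * Num.min (c * tail Q (EFin \o g) z) (2^-1 ^+ j))%:E).
Proof.
apply/measurable_EFinP; apply: measurable_funM => //.
by apply/measurable_EFinP; exact: measurable_min_tail.
Qed.

Let mdyad : measurable_fun (`[0, +oo[ : set R)
  (fun z => dyadic_root p (c * tail Q (EFin \o g) z)).
Proof.
by apply: ge0_emeasurable_sum => j *; [rewrite lee_fin dyadic_term_ge0|exact: mterm].
Qed.

Lemma dyadic_integralE : dyadic_integral Q g c = (\sum_(j <oo) (dyadic_coef p j)%:E *
  \int[leb]_(z in `[0%R, +oo[)
    (Num.min (c * tail Q (EFin \o g) z) (2^-1 ^+ j))%:E)%E.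
Proof.
rewrite /dyadic_integral /dyadic_root integral_nneseries//; last first.
  by move=> *; rewrite lee_fin dyadic_term_ge0.
apply: eq_eseriesr => j _; under eq_integral do rewrite EFinM.
rewrite ge0_integralZl//.
- exact: measurable_min_tail.
- by move=> *; rewrite lee_fin le_min ct0 exprn_ge0 ?invr_ge0.
- by rewrite lee_fin dyadic_coef_ge0.
Qed.

Lemma root_le_dyadic :
  (root_integral Q g c * dyadic_root p 1 <= 2%:E * dyadic_integral Q g c)%E.
Proof.
have [phi phi0 E1] := dyadic_root1_fin p1.
rewrite E1 muleC -!ge0_integralZl//; last 4 first.
- by move=> *; exact: (dyadic_root_ge0 p1).
- exact: mroot.
- by move=> *; rewrite lee_fin powR_ge0.
- by rewrite lee_fin ltW.
apply: ge0_le_integral => //.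
- by move=> *; rewrite mule_ge0 ?lee_fin ?powR_ge0 ?(ltW phi0).
- by apply: measurable_funeM; exact: mroot.
- exact: measurable_funeM.
- move=> z _; rewrite muleC -E1.
  by have [] := dyadic_root_equiv p1 (ct0 z) (ct1 z).
Qed.

Lemma dyadic_le_root :
  (dyadic_integral Q g c <= 2%:E * (root_integral Q g c * dyadic_root p 1))%E.
Proof.
have [phi phi0 E1] := dyadic_root1_fin p1.
rewrite muleA muleC E1 muleA -EFinM -ge0_integralZl//; last 3 first.
- exact: mroot.
- by move=> *; rewrite lee_fin powR_ge0.
- by rewrite lee_fin mulr_ge0 ?(ltW phi0).
apply: ge0_le_integral => //.
- by move=> *; exact: (dyadic_root_ge0 p1).
- by apply: measurable_funeM; exact: mroot.
- move=> z _.
  have [_] := dyadic_root_equiv p1 (ct0 z) (ct1 z); rewrite E1.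
  rewrite -!EFinM.
  by rewrite (_ : 2 * _ * phi = phi * 2 * (c * tail Q (EFin \o g) z) `^ p^-1)//; ring.
Qed.

End tail_integrals.

(** Each term of [dyadic_integral] is a truncated tail, so
    [kruglov_min_tail] applies term by term. *)
Lemma kruglov_dyadic : (dyadic_integral P (kruglov B f) 1 <=
  \sum_(k <oo) dyadic_integral lebesgue01 f (invfact k))%E.
Proof.
have min0 c j z : 0 <= c ->
    (0 <= (Num.min (c * tail lebesgue01 (EFin \o f) z) (2^-1 ^+ j))%:E)%E.
  by move=> c0; rewrite lee_fin le_min mulr_ge0 ?tail_ge0// exprn_ge0 ?invr_ge0.
have c0 k : 0 <= invfact k :> R by rewrite ltW ?invfact_gt0.
have I0 j k : (0 <= \int[leb]_(z in `[0%R, +oo[)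
    (Num.min (invfact k * tail lebesgue01 (EFin \o f) z) (2^-1 ^+ j))%:E)%E.
  by apply: integral_ge0 => z _; exact: min0.
rewrite dyadic_integralE//; last exact: measurable_kruglov.
under [leRHS]eq_eseriesr do rewrite dyadic_integralE//.
rewrite nneseries_interchange; last first.
  by move=> k j; rewrite mule_ge0 ?lee_fin ?dyadic_coef_ge0.
apply: lee_nneseries => j.
  move=> _ _; rewrite mule_ge0 ?lee_fin ?dyadic_coef_ge0//.
  apply: integral_ge0 => z _.
  by rewrite mul1r lee_fin le_min tail_ge0 exprn_ge0 ?invr_ge0.
move=> _; rewrite nneseriesZl//; apply: lee_wpmul2l.
  by rewrite lee_fin dyadic_coef_ge0.
under eq_integral do rewrite mul1r.
by apply: kruglov_min_tail => //; rewrite exprn_gt0 ?invr_gt0.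
Qed.

(** The factor 4 comes from replacing the p-th root by [dyadic_root] and back;
    between the two replacements the triangle inequality is
    [kruglov_dyadic]. *)
Lemma lorentz_upper : (lorentz_norm psi (EFin \o f) <= 1)%E ->
  (lorentz_norm psi (rearrangement P (EFin \o kruglov B f)) <=
   (4 * poisson_bound p)%:E)%E.
Proof.
move=> f1; have [phi phi0 E1] := dyadic_root1_fin p1.
have normE d (T : measurableType d) (Q : probability T R) (g : T -> R) :
    measurable_fun setT g -> (\int[lebesgue_stieltjes_measure psi]_(s in `]0%R, 1%R])
     rearrangement Q (EFin \o g) s)%E = root_integral Q g 1.
  move=> mg; rewrite lorentz_int_rearrangement; last exact/measurable_EFinP.
  by apply: eq_integral => z _; rewrite mul1r.
have scale k : (root_integral lebesgue01 f (invfact k) <= (invfact k `^ p^-1)%:E)%E.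
  have c0 : 0 < invfact k :> R by exact: invfact_gt0.
  have -> : root_integral lebesgue01 f (invfact k) =
      ((invfact k `^ p^-1)%:E * root_integral lebesgue01 f 1)%E.
    rewrite /root_integral -ge0_integralZl//; last 3 first.
    - apply/measurable_EFinP; apply: (measurableT_comp (f := @powR R ^~ p^-1)) => //.
      by apply: measurable_funM => //; exact: measurable_tail.
    - by move=> *; rewrite lee_fin powR_ge0.
    - by rewrite lee_fin powR_ge0.
    apply: eq_integral => z _; rewrite -EFinM mul1r powRM ?tail_ge0//.
    exact: ltW.
  apply: (@le_trans _ _ ((invfact k `^ p^-1)%:E * 1)%E); last by rewrite mule1.
  by apply: lee_wpmul2l; [rewrite lee_fin powR_ge0|rewrite -normE].
rewrite /lorentz_norm rearrangement_idem// normE; last exact: measurable_kruglov.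
rewrite -(@lee_pmul2r _ phi%:E)// -E1.
apply: (le_trans (root_le_dyadic _ _ _ _)) => //; first exact: measurable_kruglov.
apply: (@le_trans _ _ (2%:E * \sum_(k <oo) (2 * phi * invfact k `^ p^-1)%:E)%E).
  apply: lee_wpmul2l => //; apply: (le_trans kruglov_dyadic).
  apply: lee_nneseries => k.
    move=> _ _; apply: integral_ge0 => z _; apply: (dyadic_root_ge0 p1).
    by rewrite mulr_ge0 ?tail_ge0// ltW ?invfact_gt0.
  move=> _; apply: (le_trans (dyadic_le_root _ _ _ _)) => //.
    by rewrite ltW ?invfact_gt0.
  rewrite E1 -mulrA EFinM lee_wpmul2l// mulrC EFinM.
  by rewrite lee_wpmul2r// lee_fin ltW.
under eq_eseriesr do rewrite EFinM.
rewrite nneseriesZl; last by move=> *; rewrite lee_fin powR_ge0.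
rewrite muleA -EFinM E1.
apply: (@le_trans _ _ ((2 * (2 * phi))%:E * (poisson_bound p)%:E)%E).
  apply: lee_wpmul2l; first by rewrite lee_fin !mulr_ge0 ?(ltW phi0).
  exact: nneseries_root_invfact.
rewrite -!EFinM lee_fin le_eqVlt; apply/orP; left; apply/eqP; ring.
Qed.

End lorentz_upper_bound.

(** * Lower bounds *)

Section constant_one.
Variable R : realType.
Local Notation leb := (@lebesgue_measure R).
Implicit Types p t : R.

Lemma integral_ge_cst (F : R -> R) (v y : R) : 0 <= v -> 0 <= y ->
  measurable_fun (`[0, +oo[ : set R) (EFin \o F) -> (forall z, 0 <= F z) ->
  (forall z, 0 <= z -> z < y -> v <= F z) ->
  ((y * v)%:E <= \int[leb]_(z in `[0%R, +oo[) (F z)%:E)%E.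
Proof.
move=> v0 y0 mF F0 vF.
have sub : (`[0, y[ : set R) `<=` `[0, +oo[.
  by apply: subset_itvl; rewrite bnd_simp.
apply: (@le_trans _ _ (\int[leb]_(z in `[0%R, y[) (F z)%:E)%E); last first.
  by apply: ge0_subset_integral => // z _; rewrite lee_fin.
apply: (@le_trans _ _ (\int[leb]_(z in `[0%R, y[) cst v%:E z)%E).
  by rewrite integral_cst//= lebesgue_measure_itv0// mulrC.
apply: ge0_le_integral => //.
  by apply: measurable_funS mF.
by move=> z /=; rewrite in_itv/= => /andP[z0 zy]; rewrite lee_fin vF.
Qed.

Lemma tail_cst1 (z : R) : 0 <= z ->
  tail lebesgue01 (EFin \o cst (1%R : R)) z = (z < 1)%R%:R.
Proof.
move=> z0; rewrite /tail; have [z1|z1] := ltP z 1.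
  rewrite [X in lebesgue01 X](_ : _ = setT) ?lebesgue01_setT//.
  by rewrite -subTset => x _ /=; rewrite normr1 lte_fin.
rewrite [X in lebesgue01 X](_ : _ = set0) ?measure0//.
by rewrite -subset0 => x /=; rewrite normr1 lte_fin ltNge z1.
Qed.

Lemma integral_lt1 (v : R) : 0 <= v ->
  (\int[leb]_(z in `[0%R, +oo[) ((z < 1)%R%:R * v)%:E = v%:E)%E.
Proof.
move=> v0; transitivity
    (\int[leb]_(z in `[0%R, +oo[) (v%:E * (\1_(`]-oo, 1[ : set R) z)%:E))%E.
  apply: eq_integral => z _; rewrite -EFinM mulrC indicE.
  by congr ((_ * _%:R)%:E); rewrite mem_setE in_itv.
rewrite ge0_integralZl//; last first.
  by apply/measurable_EFinP; exact: measurable_indic.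
rewrite integral_indic//= (_ : _ `&` _ = `[0, 1[%classic).
  by rewrite lebesgue_measure_itv0// mule1.
by apply/seteqP; split => z /=; rewrite !in_itv/= andbT;
  [move=> [-> ->]|move=> /andP[-> ->]].
Qed.

Lemma Lp_cst1 p : Lp_norm p (EFin \o cst (1%R : R)) = 1%E.
Proof. by rewrite /Lp_norm Lnorm_cst1 [X in poweR X _]lebesgue01_setT poweR1r. Qed.

Let mcst : measurable_fun [set: R] (EFin \o cst (1%R : R)).
Proof. by apply/measurable_EFinP. Qed.

Lemma lorentz_cst1 p (p1 : 1 < p) :
  lorentz_norm (root_fun p1) (EFin \o cst (1%R : R)) = 1%E.
Proof.
rewrite /lorentz_norm lorentz_int_rearrangement//.
rewrite -[RHS](@integral_lt1 1%R ler01).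
apply: eq_integral => z; rewrite inE/= in_itv/= andbT => z0.
rewrite tail_cst1//; case: (z < 1); first by rewrite powR1 mulr1.
by rewrite powR0 ?mul0r// invr_eq0 gt_eqF// (lt_trans _ p1).
Qed.

Lemma marcinkiewicz_cst1 p (p1 : 1 < p) :
  (marcinkiewicz_norm (root_fun p1) (EFin \o cst (1%R : R)) <= 1)%E.
Proof.
apply: ge_ereal_sup => _ [t /= + <-]; rewrite in_itv/= => /andP[t0 t1].
rewrite int_rearrangement ?(ltW t0)// root_funE ?(ltW t0)//.
have -> : (\int[leb]_(z in `[0%R, +oo[)
    (Num.min (tail lebesgue01 (EFin \o cst (1%R : R)) z) t)%:E = t%:E)%E.
  rewrite -[RHS](integral_lt1 (ltW t0)).
  apply: eq_integral => z; rewrite inE/= in_itv/= andbT => z0.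
  rewrite tail_cst1//.
  by case: (z < 1); [rewrite min_r// mul1r|rewrite min_l ?mul0r ?(ltW t0)].
rewrite -EFinM divfK ?gt_eqF// lee_fin.
rewrite [leRHS](_ : 1 = 1 `^ p^-1); last by rewrite powR1.
by rewrite ge0_ler_powR ?nnegrE ?(ltW t0) ?invr_ge0// ltW// (lt_trans _ p1).
Qed.

End constant_one.

Section poisson_lower.
Variable R : realType.
Implicit Types p : R.

Lemma fact_le_exp n m : (n <= m)%N -> (n`! <= m ^ n)%N.
Proof.
elim: n => // n IH nm; rewrite factS expnS leq_mul// IH//; exact: ltnW.
Qed.

Definition poisson_weight (n : nat) : R := (expR 1 * n`!%:R)^-1.

Lemma poisson_weight_gt0 n : 0 < poisson_weight n.
Proof. by rewrite invr_gt0 mulr_gt0 ?expR_gt0// ltr0n fact_gt0. Qed.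

(** For n = floor (p / ln (p + 1)) + 1 one has n ln n = O(p), so that the weight
    1/(e n!) >= 1/(e n^n) is at least e^(-7p) and its p-th root is bounded below. *)
Lemma exists_poisson_lower p : 1 < p -> exists2 n, (0 < n)%N &
  expR (- 7) * (p / ln (p + 1)) <= n%:R * poisson_weight n `^ p^-1.
Proof.
move=> p1; have p0 : 0 < p by rewrite (lt_trans _ p1).
have L0 := ln1p_gt0 p1; set L := ln (p + 1) in L0 *.
have Lp : L <= p by rewrite /L addrC le_ln1Dx// (lt_trans _ p0)// oppr_lt0.
have L2 : 2^-1 <= L.
  have : ln (1 + ((p + 1)^-1 - 1)) <= (p + 1)^-1 - 1.
    by rewrite le_ln1Dx// ltrBrDl subrr invr_gt0 addr_gt0.
  rewrite addrCA subrr addr0 lnV ?posrE ?addr_gt0// -/L.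
  have : (p + 1)^-1 <= 2^-1 by rewrite lef_pV2 ?posrE ?addr_gt0//; lra.
  lra.
pose x := p / L; have x1 : 1 <= x by rewrite ler_pdivlMr// mul1r.
have := @truncn_itv _ x (le_trans ler01 x1); set m := Num.trunc x => /andP[mx xm].
exists m.+1 => //; set n := m.+1.
have nx : n%:R <= 2 * x by rewrite /n -(natr1 m); lra.
have nL : n%:R * L <= 2 * p.
  by move: nx; rewrite /x -(ler_pM2r L0) -mulrA divfK ?gt_eqF.
(* As n <= 4p <= (p + 1)^3, ln n is at most 3L. *)
have n3 : n%:R <= expR (3 * L).
  rewrite expRM_natl lnK ?posrE ?addr_gt0//.
  have n4 : n%:R <= 4 * p by have := ler_wpM2l (ler0n R n) L2; lra.
  apply: (le_trans n4); rewrite !exprS expr0 mulr1.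
  have : 2 * 2 * p <= (p + 1) * (p + 1) * (p + 1) by apply: ler_pM; [lra|lra|nra|lra].
  by lra.
have nfact : expR 1 * n`!%:R <= expR (7 * p).
  apply: (@le_trans _ _ (expR 1 * n%:R ^+ n)).
    by rewrite ler_pM2l ?expR_gt0// -natrX ler_nat fact_le_exp.
  apply: (@le_trans _ _ (expR 1 * expR (3 * L) ^+ n)).
    by rewrite ler_pM2l ?expR_gt0// lerXn2r ?nnegrE ?expR_ge0.
  by rewrite -expRM_natl -expRD ler_expR; move: nL p1; lra.
have w : expR (- 7) <= poisson_weight n `^ p^-1.
  apply: (@le_trans _ _ (expR (- (7 * p)) `^ p^-1)).
    by rewrite -expRM ler_expR mulNr mulfK ?gt_eqF.
  apply: ge0_ler_powR;
    rewrite ?nnegrE ?invr_ge0 ?(ltW p0) ?expR_ge0 ?(ltW (poisson_weight_gt0 _))//.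
  by rewrite expRN lef_pV2 ?posrE ?expR_gt0// mulr_gt0 ?expR_gt0// ltr0n fact_gt0.
rewrite mulrC ler_pM ?expR_ge0 ?(le_trans ler01 x1)//.
exact: ltW.
Qed.

End poisson_lower.

Section lower_bounds.
Variables (R : realType) (P : probability (seq_space R) R) (B : nat -> set R).
Hypotheses (HP : is_product01 P) (HB : kruglov_partition B).
Variables (p : R) (p1 : 1 < p) (n : nat).
Hypothesis n0 : (0 < n)%N.
Local Notation leb := (@lebesgue_measure R).
Local Notation K1 := (EFin \o kruglov B (cst (1%R : R))).
Local Notation beta := (@poisson_weight R n).

Let p0 : 0 < p. Proof. by rewrite (lt_trans _ p1). Qed.
Let beta0 : 0 < beta := poisson_weight_gt0 R n.

Let mK : measurable_fun setT K1.
Proof. by apply/measurable_EFinP; exact: measurable_kruglov. Qed.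

Let PB : P [set w | B n (w 0%N)] = beta%:E.
Proof.
by rewrite coord0_measure ?lebesgue01_B//; exact: kruglov_measurableB.
Qed.

Let K1_on (w : seq_space R) : B n (w 0%N) -> kruglov B (cst (1%R : R)) w = n%:R.
Proof. by move=> Bw; rewrite (kruglov_on HB _ n0 Bw) sumr_const card_ord. Qed.

Let mB : measurable [set w : seq_space R | B n (w 0%N)].
Proof.
rewrite -[X in measurable X]setTI; apply: (measurable_coord 0) => //.
exact: kruglov_measurableB.
Qed.

Lemma tail_kruglov1 z : z < n%:R -> beta <= tail P K1 z.
Proof.
move=> zn; rewrite -lee_fin EFin_tail// -PB le_measure ?inE//.
  exact: measurable_tail_set.
by move=> w /= Bw; rewrite (K1_on Bw) lte_fin ger0_norm.
Qed.

Lemma lorentz_lower : ((n%:R * beta `^ p^-1)%:E <=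
  lorentz_norm (root_fun p1) (rearrangement P K1))%E.
Proof.
rewrite /lorentz_norm rearrangement_idem// lorentz_int_rearrangement//.
apply: integral_ge_cst => //; rewrite ?powR_ge0//.
- apply/measurable_EFinP; apply: (measurableT_comp (f := @powR R ^~ p^-1)) => //.
  exact: measurable_tail.
- by move=> z; rewrite powR_ge0.
- move=> z _ zn; rewrite ge0_ler_powR ?nnegrE ?tail_ge0 ?(ltW beta0) ?invr_ge0 ?(ltW p0)//.
  exact: tail_kruglov1.
Qed.

Lemma marcinkiewicz_lower : ((n%:R * beta `^ p^-1)%:E <=
  marcinkiewicz_norm (root_fun p1) (rearrangement P K1))%E.
Proof.
have beta1 : beta <= 1 by rewrite -lee_fin -PB probability_le1.
apply: le_ereal_sup_tmp; eexists.
  by exists beta; first by rewrite /= in_itv/= beta0.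
rewrite rearrangement_idem// int_rearrangement ?(ltW beta0)// root_funE ?(ltW beta0)//.
rewrite [X in (X%:E <= _)%E](_ : _ = beta `^ p^-1 / beta * (n%:R * beta)); last first.
  by field; rewrite gt_eqF.
rewrite EFinM lee_wpmul2l ?lee_fin ?divr_ge0 ?powR_ge0 ?(ltW beta0)//.
apply: integral_ge_cst => //; rewrite ?(ltW beta0)//.
- apply/measurable_EFinP/measurable_minr => //; exact: measurable_tail.
- by move=> z; rewrite le_min tail_ge0 ltW.
- by move=> z _ zn; rewrite le_min lexx andbT tail_kruglov1.
Qed.

Lemma Lp_lower : ((n%:R * beta `^ p^-1)%:E <=
  Lp_norm p (rearrangement P K1))%E.
Proof.
rewrite Lp_rearrangement//.
have -> : (n%:R * beta `^ p^-1)%:E = ((n%:R `^ p * beta)%:E `^ p^-1)%E.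
  by rewrite poweR_EFin powRM ?powR_ge0 ?(ltW beta0)// powRKV.
have I0 : (0 <= \int[P]_x `|K1 x| `^ p)%E.
  by apply: integral_ge0 => w _; rewrite poweR_ge0.
apply: gt0_ler_poweR; rewrite ?invr_ge0 ?(ltW p0) ?in_itv/= ?leey ?andbT//.
  by rewrite lee_fin mulr_ge0 ?powR_ge0 ?(ltW beta0).
rewrite EFinM -PB -integral_cst//.
apply: (@le_trans _ _ (\int[P]_(w in [set w | B n (w 0%N)]) (`|K1 w| `^ p))%E).
  rewrite le_eqVlt; apply/orP; left; apply/eqP; apply: eq_integral => w.
  by rewrite inE => Bw; rewrite /= (K1_on Bw) ger0_norm.
apply: ge0_subset_integral => //.
  by apply: (measurableT_comp (measurable_poweR _)); exact: measurableT_comp.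
by move=> w _; exact: poweR_ge0.
Qed.

End lower_bounds.

(** * The norm equivalence *)

Theorem theorem7 (R : realType) :
  exists a b : R, [/\ 0 < a, a < b &
    forall (P : probability (seq_space R) R) (B : nat -> set R),
      is_product01 P -> kruglov_partition B ->
      forall (p : R) (p1 : 1 < p),
        let psi := root_fun p1 in
        let lower := (a * (p / ln (p + 1)))%:E in
        let upper := (b * (p / ln (p + 1)))%:E in
        [/\ (lower <= kruglov_opnorm P B (Lp_norm p) (Lp_norm p) <= upper)%E,
            (lower <= kruglov_opnorm P B (lorentz_norm psi) (lorentz_norm psi)
               <= upper)%E &
            (lower <= kruglov_opnorm P B (marcinkiewicz_norm psi)
                        (marcinkiewicz_norm psi) <= upper)%E]].
Proof.
exists (expR (- 7)), (8 * expR 2); split; first exact: expR_gt0.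
  apply: (@lt_trans _ _ 1); first by rewrite expR_lt1 oppr_lt0.
  by have := expR_ge1Dx (2 : R); lra.
move=> P B HP HB p p1 psi lower upper.
have [n n0 nlow] := exists_poisson_lower p1.
have bound : ((poisson_bound p)%:E <= upper)%E.
  rewrite lee_fin /poisson_bound ler_pM2r; last first.
    by rewrite divr_gt0 ?ln1p_gt0// (lt_trans _ p1).
  by rewrite ler_pM2r ?expR_gt0 ?ler_nat.
have sup_lower (NX NY : (R -> \bar R) -> \bar R) :
    (NX (EFin \o cst 1%R) <= 1)%E ->
    ((n%:R * poisson_weight R n `^ p^-1)%:E <=
      NY (rearrangement P (EFin \o kruglov B (cst 1%R))))%E ->
    (lower <= kruglov_opnorm P B NX NY)%E.
  move=> N1 NK; apply: le_ereal_sup_tmp; eexists; first by exists (cst 1%R).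
  by apply: le_trans NK; rewrite lee_fin.
split; apply/andP; split.
- by apply: sup_lower; [rewrite Lp_cst1|exact: Lp_lower].
- apply: ge_ereal_sup => _ [f [mf f1] <-]; apply: le_trans bound.
  exact: Lp_upper.
- by apply: sup_lower; [rewrite lorentz_cst1|exact: lorentz_lower].
- apply: ge_ereal_sup => _ [f [mf f1] <-].
  apply: (le_trans (lorentz_upper HP HB mf f1)).
  by rewrite lee_fin /poisson_bound !mulrA -natrM.
- by apply: sup_lower; [exact: marcinkiewicz_cst1|exact: marcinkiewicz_lower].
- apply: ge_ereal_sup => _ [f [mf f1] <-]; apply: le_trans bound.
  exact: marcinkiewicz_upper.
Qed.
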